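(* The spherical derivatives of the Clifford powers $x^m$ in $\mathbb{R}_3$ coincide on $\mathbb{R}^4$ (the paravector space of $\mathbb{R}_3$), up to a constant, with the zonal harmonics with pole $1\in\partial\mathbb{B}$. More precisely, for every integer $m\ge1$ and every $a\in\partial\mathbb{B}$: (a) $\mathcal{Z}_{m-1}(x,1)=m\,(x^m)'_s$ for $x\in\mathbb{R}^4$. Therefore $\overline\partial(x^m)=-\frac2m\mathcal{Z}_{m-1}(x,1)$. (b) For $x\in\mathbb{R}^4$, $$\mathcal{Z}_{m-1}(x,a)=\mathcal{Z}_{m-1}(xa^c,1)=m\,(y^m)'_s\big|_{y=xa^c}=m\sum_{k=0}^{m-1}(xa^c)^{m-k-1}(ax^c)^k.$$ (c) $(x^{-m})'_s=-\mathcal{K}\left[(x^m)'_s\right]$, where $\mathcal{K}$ is the Kelvin transform in $\mathbb{R}^4$. The functions $(x^{-m})'_s$ are harmonic on $\mathbb{R}^4\setminus\{0\}$. (d) The restriction of $(x^m)'_s$ to the unit sphere $\partial\mathbb{B}$ is equal to the Gegenbauer polynomial $C^{(1)}_{m-1}(\operatorname{Re}(x))$.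
   Context: $\mathbb{R}_3$ is the real Clifford algebra generated by $e_1,e_2,e_3$ with $e_ie_j+e_je_i=-2\delta_{ij}$; $x\mapsto x^c$ (Clifford conjugation) is the unique linear antiinvolution with $e_i^c=-e_i$. The paravector space $\{x_0+x_1e_1+x_2e_2+x_3e_3\}$ is identified with $\mathbb{R}^4$; $\mathbb{B}$ is the open unit ball in $\mathbb{R}^4$; $\overline\partial=\frac{\partial}{\partial x_0}+\sum_{i=1}^3e_i\frac{\partial}{\partial x_i}$. Let $\mathbb{S}_{\mathbb{R}_3}=\{J\in\mathbb{R}_3: J+J^c=0,\ JJ^c=1\}$ and let $\mathcal{Q}_{\mathbb{R}_3}=\bigcup_{J\in\mathbb{S}_{\mathbb{R}_3}}\langle1,J\rangle$ be the quadratic cone, equal to $\{x\in\mathbb{R}_3: x+x^c\in\mathbb{R},\ xx^c\in\mathbb{R}\}$; it contains $\mathbb{R}^4$ and also all products $xa^c$ with $x,a\in\mathbb{R}^4$. For $x\in\mathcal{Q}_{\mathbb{R}_3}$, $\operatorname{Re}(x)=\frac{x+x^c}{2}$, $\operatorname{Im}(x)=\frac{x-x^c}{2}$. The spherical derivative of a function $f$ is $f'_s(x)=\frac12\operatorname{Im}(x)^{-1}(f(x)-f(x^c))$ for $x\in\mathcal{Q}_{\mathbb{R}_3}\setminus\mathbb{R}$; for the powers $x^m$ ($m\in\mathbb{Z}$, $x\ne0$ if $m<0$) it extends continuously to real points. $(x^m)'_s$ denotes the spherical derivative of $x\mapsto x^m$. $\mathcal{Z}_m(x,a)$, $a\in\partial\mathbb{B}$,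 is the four-dimensional (solid) zonal harmonic of degree $m$ with pole $a$: the unique homogeneous harmonic polynomial of degree $m$ in $x\in\mathbb{R}^4$ such that $p(a)=\int_{\partial\mathbb{B}}p(\zeta)\mathcal{Z}_m(\zeta,a)\,d\sigma(\zeta)$ for every homogeneous harmonic polynomial $p$ of degree $m$ on $\mathbb{R}^4$, with $\sigma$ the normalized surface measure (so $\mathcal{Z}_m(a,a)=(m+1)^2$). Since $\mathcal{Z}_m(y,1)$ depends, for $y\in\mathbb{R}^4$, only on $\operatorname{Re}(y)$ and $|\operatorname{Im}(y)|$, for $y\in\mathcal{Q}_{\mathbb{R}_3}$ the symbol $\mathcal{Z}_m(y,1)$ denotes its value at any paravector with the same real part and same $|\operatorname{Im}|$ as $y$. The Kelvin transform in $\mathbb{R}^4$ is $\mathcal{K}[f](x)=|x|^{-2}f(x/|x|^2)$. $C^{(1)}_k$ is the Gegenbauer polynomial of degree $k$ with parameter $1$. *)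

(* Defs.v *)
From HB Require Import structures.
From mathcomp Require Import all_boot all_order all_algebra.
From mathcomp Require Import all_classical all_reals all_analysis.
From mathcomp Require Import ring.
From mathcomp Require Import -(notations) mpoly.

Set Implicit Arguments.
Unset Strict Implicit.
Unset Printing Implicit Defensive.

Import Order.TTheory GRing.Theory Num.Theory.
Import numFieldNormedType.Exports.

Local Open Scope classical_set_scope.
Local Open Scope ring_scope.

Definition symdiff (T : finType) (A B : {set T}) : {set T} :=
  ((A :\: B) :|: (B :\: A))%SET.

(* The real Clifford algebra with e_i e_j + e_j e_i = -2 delta_ij.
   The coordinate of index [enum_rank A] is the coefficient of e_A, the product
   of the generators e_i, i in A, taken in increasing order of i. *)
Definition clifford (R : realType) (n : nat) : Type := 'rV[R]_#|{set 'I_n}|.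

HB.instance Definition _ (R : realType) (n : nat) :=
  NormedModule.copy (clifford R n) 'rV[R]_#|{set 'I_n}|.

Section Clifford.
Variables (R : realType) (n : nat).
Implicit Types (A B C : {set 'I_n}) (x y z : clifford R n).

Definition clcoef x A : R := x 0 (enum_rank A).

Definition clbasis A : clifford R n := delta_mx 0 (enum_rank A).

(* e_A * e_B = clsign A B * e_(A symdiff B): moving e_j to the left of e_i
   costs a factor -1 for each i > j, and e_i * e_i = -1. *)
Definition clsign A B : R := \prod_(i in A) \prod_(j in B | (j <= i)%N) (- 1).

Definition clmul x y : clifford R n :=
  \sum_A \sum_B (clcoef x A * clcoef y B * clsign A B) *: clbasis (symdiff A B).

Lemma clcoef_is_scalar A : scalar (clcoef^~ A).
Proof. by move=> k x y; rewrite /clcoef mxE mxE. Qed.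

Lemma clcoefB A B : clcoef (clbasis B) A = (A == B)%:R.
Proof. by rewrite /clcoef /clbasis mxE eqxx (inj_eq enum_rank_inj). Qed.

Lemma clifford_eqP x y : (forall A, clcoef x A = clcoef y A) -> x = y.
Proof.
move=> h; apply/rowP => k.
by have := h (enum_val k); rewrite /clcoef enum_valK.
Qed.

Lemma in_symdiff A B i : (i \in symdiff A B) = (i \in A) (+) (i \in B).
Proof. by rewrite !inE; case: (i \in A); case: (i \in B). Qed.

Lemma symdiffA A B C : symdiff A (symdiff B C) = symdiff (symdiff A B) C.
Proof. by apply/finset.setP => i; rewrite !in_symdiff addbA. Qed.

Lemma symdiffC A B : symdiff A B = symdiff B A.
Proof. by apply/finset.setP => i; rewrite !in_symdiff addbC. Qed.

Lemma symdiffK A : cancel (symdiff A) (symdiff A).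
Proof. by move=> B; apply/finset.setP => i; rewrite !in_symdiff addbA addbb. Qed.

Lemma symdiff0 A : symdiff A finset.set0 = A.
Proof. by apply/finset.setP => i; rewrite in_symdiff inE addbF. Qed.

Lemma symdiff0l A : symdiff finset.set0 A = A.
Proof. by rewrite symdiffC symdiff0. Qed.

Lemma symdiff_eq A B C : (C == symdiff A B) = (B == symdiff A C).
Proof. by apply/eqP/eqP => ->; rewrite symdiffK. Qed.

Lemma prod_symdiff (P : pred 'I_n) (F : 'I_n -> R) A B :
  (forall i, F i * F i = 1) ->
  \prod_(i in symdiff A B | P i) F i =
  (\prod_(i in A | P i) F i) * (\prod_(i in B | P i) F i).
Proof.
move=> F2; rewrite big_mkcondl /= [X in _ = X * _]big_mkcondl.
rewrite [X in _ = _ * X]big_mkcondl -big_split /=.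
apply: eq_bigr => i _; rewrite in_symdiff.
by case: (i \in A); case: (i \in B); rewrite ?F2 ?mul1r ?mulr1.
Qed.

Lemma clsign_sq A B : clsign A B * clsign A B = 1.
Proof.
rewrite /clsign -big_split big1 // => i _ /=.
by rewrite -big_split big1 // => j _ /=; rewrite mulrNN mulr1.
Qed.

Lemma clsignDr A B C : clsign A (symdiff B C) = clsign A B * clsign A C.
Proof.
rewrite /clsign -big_split; apply: eq_bigr => i _ /=.
by rewrite prod_symdiff // => _; rewrite mulrNN mulr1.
Qed.

Lemma clsignDl A B C : clsign (symdiff A B) C = clsign A C * clsign B C.
Proof.
rewrite /clsign; set F := fun i : 'I_n => \prod_(j in C | (j <= i)%N) (- 1 : R).
have F2 i : F i * F i = 1.
  by rewrite /F -big_split big1 // => j _ /=; rewrite mulrNN mulr1.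
have E D : \prod_(i in D) F i = \prod_(i in D | predT i) F i.
  by apply: eq_bigl => i; rewrite andbT.
by rewrite !E prod_symdiff.
Qed.

Lemma clsign0l A : clsign finset.set0 A = 1.
Proof. by rewrite /clsign big_set0. Qed.

Lemma clsign0r A : clsign A finset.set0 = 1.
Proof. by rewrite /clsign big1 // => i _; rewrite big1 // => j; rewrite inE. Qed.

Lemma clcoef_sum (I : finType) (F : I -> clifford R n) A :
  clcoef (\sum_i F i) A = \sum_i clcoef (F i) A.
Proof. by rewrite /clcoef summxE. Qed.

Lemma clcoefD x y A : clcoef (x + y) A = clcoef x A + clcoef y A.
Proof. by rewrite /clcoef mxE. Qed.

Lemma clcoefZ k x A : clcoef (k *: x) A = k * clcoef x A.
Proof. by rewrite /clcoef mxE. Qed.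

Lemma clcoefM x y C :
  clcoef (clmul x y) C =
  \sum_A clcoef x A * clcoef y (symdiff A C) * clsign A (symdiff A C).
Proof.
rewrite /clmul clcoef_sum; apply: eq_bigr => A _.
rewrite clcoef_sum (bigD1 (symdiff A C)) //= clcoefZ clcoefB symdiffK eqxx.
rewrite mulr1 big1 ?addr0 // => B; rewrite clcoefZ clcoefB symdiff_eq.
by move/negPf->; rewrite mulr0.
Qed.

Fact clmulA : associative clmul.
Proof.
move=> x y z; apply: clifford_eqP => D; rewrite !clcoefM.
under eq_bigr => A _ do rewrite clcoefM mulr_sumr mulr_suml.
under [RHS]eq_bigr => C _ do rewrite clcoefM !mulr_suml.
rewrite [RHS]exchange_big /=; apply: eq_bigr => A _.
rewrite [RHS](reindex_inj (can_inj (symdiffK A))) /=; apply: eq_bigr => B _.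
rewrite symdiffK [symdiff (symdiff A B) D]symdiffC.
rewrite [symdiff D _]symdiffC -[symdiff (symdiff A B) D]symdiffA.
rewrite [symdiff A (symdiff B D)]symdiffA [symdiff A B]symdiffC -symdiffA.
set E := symdiff B (symdiff A D).
have -> : symdiff A D = symdiff B E by rewrite /E symdiffK.
by rewrite clsignDr clsignDl; ring.
Qed.

Fact clmul1x : left_id (clbasis finset.set0) clmul.
Proof.
move=> x; apply: clifford_eqP => C; rewrite clcoefM (bigD1 finset.set0) //=.
rewrite clcoefB eqxx symdiff0l clsign0l mul1r mulr1 big1 ?addr0 // => A.
by rewrite clcoefB => /negPf->; rewrite !mul0r.
Qed.

Fact clmulx1 : right_id (clbasis finset.set0) clmul.
Proof.
move=> x; apply: clifford_eqP => C; rewrite clcoefM (bigD1 C) //=.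
have -> : symdiff C C = finset.set0 by rewrite -{2}[C]symdiff0 symdiffK.
rewrite clcoefB eqxx clsign0r !mulr1 big1 ?addr0 // => A neqAC.
rewrite clcoefB eq_sym symdiff_eq symdiff0 eq_sym (negPf neqAC).
by rewrite mulr0 mul0r.
Qed.

Fact clmulDl : left_distributive clmul +%R.
Proof.
move=> x y z; apply: clifford_eqP => C; rewrite clcoefD !clcoefM -big_split.
by apply: eq_bigr => A _; rewrite clcoefD /=; ring.
Qed.

Fact clmulDr : right_distributive clmul +%R.
Proof.
move=> x y z; apply: clifford_eqP => C; rewrite clcoefD !clcoefM -big_split.
by apply: eq_bigr => A _; rewrite clcoefD /=; ring.
Qed.

Fact cl1_neq0 : clbasis finset.set0 != 0 :> clifford R n.
Proof.
apply/eqP => /(congr1 (clcoef^~ finset.set0)).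
by rewrite clcoefB eqxx /clcoef mxE => /eqP; rewrite oner_eq0.
Qed.

HB.instance Definition _ := GRing.Zmodule_isNzRing.Build (clifford R n)
  clmulA clmul1x clmulx1 clmulDl clmulDr cl1_neq0.

Fact clscaleAl (k : R) x y : k *: (x * y) = (k *: x) * y.
Proof.
apply: clifford_eqP => C; rewrite clcoefZ !clcoefM mulr_sumr.
by apply: eq_bigr => A _; rewrite clcoefZ; ring.
Qed.

HB.instance Definition _ :=
  GRing.Lmodule_isLalgebra.Build R (clifford R n) clscaleAl.

Fact clscaleAr (k : R) x y : k *: (x * y) = x * (k *: y).
Proof.
apply: clifford_eqP => C; rewrite clcoefZ !clcoefM mulr_sumr.
by apply: eq_bigr => A _; rewrite clcoefZ; ring.
Qed.

HB.instance Definition _ :=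
  GRing.Lalgebra_isAlgebra.Build R (clifford R n) clscaleAr.

Definition clinvertible x : Prop := exists y, y * x = 1 /\ x * y = 1.

Definition clinv x : clifford R n :=
  xget x [set y | y * x = 1 /\ x * y = 1].

Fact clinvP x : x \in [pred x | `[< clinvertible x >]] ->
  clinv x * x = 1 /\ x * clinv x = 1.
Proof. by move=> /asboolP[y hy]; rewrite /clinv; case: xgetP => [z _ //|/(_ y)]. Qed.

Fact clmulVr :
  {in [pred x | `[< clinvertible x >]], left_inverse 1 clinv *%R}.
Proof. by move=> x /clinvP[]. Qed.

Fact cldivrr :
  {in [pred x | `[< clinvertible x >]], right_inverse 1 clinv *%R}.
Proof. by move=> x /clinvP[]. Qed.

Fact clunitP x y : y * x = 1 /\ x * y = 1 ->
  [pred x | `[< clinvertible x >]] x.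
Proof. by move=> h; apply/asboolP; exists y. Qed.

Fact clinv_out :
  {in [predC [pred x | `[< clinvertible x >]]], clinv =1 id}.
Proof.
move=> x /negP nx; rewrite /clinv; case: xgetP => [y _ hy|//].
by case: nx; apply/asboolP; exists y.
Qed.

HB.instance Definition _ := GRing.NzRing_hasMulInverse.Build (clifford R n)
  clmulVr cldivrr clunitP clinv_out.

Definition clgen (i : 'I_n) : clifford R n := clbasis [set i]%SET.

(* The value on e_A is clsign A A * e_A, the inverse of e_A. *)
Definition clconj x : clifford R n :=
  \sum_A (clsign A A * clcoef x A) *: clbasis A.

Lemma clbasisM A B :
  clbasis A * clbasis B = clsign A B *: clbasis (symdiff A B).
Proof.
apply: clifford_eqP => C; rewrite clcoefM clcoefZ clcoefB (bigD1 A) //=.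
rewrite clcoefB eqxx clcoefB symdiff_eq big1 ?addr0 => [|D neqDA]; last first.
  by rewrite clcoefB (negPf neqDA) !mul0r.
by rewrite mul1r eq_sym; case: eqP => [->|_]; rewrite ?mul1r ?mul0r ?mulr1 ?mulr0.
Qed.

Lemma clgen_anticomm i j :
  clgen i * clgen j + clgen j * clgen i = - (2 * (i == j)%:R)%:A.
Proof.
rewrite /clgen !clbasisM [symdiff [set j] _]symdiffC -scalerDl.
have sg (k l : 'I_n) : clsign [set k]%SET [set l]%SET = (-1) ^+ (l <= k)%N.
  rewrite /clsign big_set1; case: (boolP (l <= k)%N) => h; last first.
    by rewrite big1 // => p; rewrite inE => /andP[/eqP -> h']; rewrite h' in h.
  rewrite (big_pred1 l) // => p /=; rewrite inE.
  by case: eqP => // ->; rewrite h.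
rewrite !sg; case: (ltngtP i j) => [h|h|/val_inj ->].
- have /negPf-> : i != j by rewrite neq_ltn h.
  by rewrite /= mulr0 scale0r oppr0 expr0 expr1 subrr scale0r.
- have /negPf-> : i != j by rewrite neq_ltn h orbT.
  by rewrite /= mulr0 scale0r oppr0 expr0 expr1 addNr scale0r.
- rewrite eqxx expr1 -{2}[[set j]%SET]symdiff0 symdiffK mulr1 -scaleNr.
  by congr (_ *: _); ring.
Qed.

Lemma clcoef_conj x A : clcoef (clconj x) A = clsign A A * clcoef x A.
Proof.
rewrite /clconj clcoef_sum (bigD1 A) //= clcoefZ clcoefB eqxx mulr1.
rewrite big1 ?addr0 // => B; rewrite clcoefZ clcoefB eq_sym.
by move=> /negPf->; rewrite mulr0.
Qed.

Lemma clconj_is_linear : linear clconj.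
Proof.
move=> k x y; apply: clifford_eqP => A.
by rewrite clcoefD clcoefZ !clcoef_conj clcoefD clcoefZ; ring.
Qed.

Lemma clconjM x y : clconj (x * y) = clconj y * clconj x.
Proof.
apply: clifford_eqP => C; rewrite clcoef_conj !clcoefM mulr_sumr.
have inj : injective (symdiff C) := can_inj (symdiffK C).
rewrite [RHS](reindex_inj inj) /=; apply: eq_bigr => A _.
rewrite !clcoef_conj [symdiff A C]symdiffC.
set B := symdiff C A.
have BC : symdiff B C = A by rewrite symdiffC /B symdiffK.
have CE : C = symdiff A B by rewrite /B [symdiff C A]symdiffC symdiffK.
clearbody B; rewrite BC CE !(clsignDl, clsignDr).
transitivity (clcoef x A * clcoef y B * clsign A A * clsign B B * clsign B A
   * (clsign A B * clsign A B)); first by ring.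
by rewrite clsign_sq; ring.
Qed.

Lemma clconj_gen i : clconj (clgen i) = - clgen i.
Proof.
apply: clifford_eqP => A; rewrite clcoef_conj /clgen -scaleN1r clcoefZ clcoefB.
case: eqP => [->|_]; last by rewrite !mulr0.
rewrite /clsign big_set1 (big_pred1 i) // => p /=.
by rewrite inE; case: eqP => // ->; rewrite leqnn.
Qed.

Definition clRe x : clifford R n := 2^-1 *: (x + clconj x).

Definition clIm x : clifford R n := 2^-1 *: (x - clconj x).

Definition clscal x : R := clcoef x finset.set0.

Definition clnorm x : R := Num.sqrt (\sum_A clcoef x A ^+ 2).

Definition clreals : set (clifford R n) := range (fun t : R => t%:A).

Definition imag_units : set (clifford R n) :=
  [set J | J + clconj J = 0 /\ J * clconj J = 1].

Definition quad_cone : set (clifford R n) :=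
  [set x | exists2 J, imag_units J & exists s t : R, x = s%:A + t *: J].

(* At real points the value is the limit along the non-real points of the
   quadratic cone. *)
Definition sph_deriv (f : clifford R n -> clifford R n) x : clifford R n :=
  let q y := 2^-1 *: ((clIm y)^-1 * (f y - f (clconj y))) in
  if x \in clreals then lim (q @ within (quad_cone `\` clreals) (nbhs x))
  else q x.

Definition paravector (x : 'rV[R]_n.+1) : clifford R n :=
  (x 0 0)%:A + \sum_(i < n) x 0 (lift ord0 i) *: clgen i.

End Clifford.

(* w is a paravector with the real part of y and the same length of the
   imaginary part: functions of (Re, |Im|) on R^4 extend to the quadratic cone
   by taking at y their value at any such w. *)
Definition same_re_im (R : realType) (n : nat) (y : clifford R n)
    (w : 'rV[R]_n.+1) : Prop :=
  clRe (paravector w) = clRe y /\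
  clnorm (clIm (paravector w)) = clnorm (clIm y).

Section Euclidean.
Variables (R : realType) (d : nat).

Definition enorm (x : 'rV[R]_d) : R := Num.sqrt (\sum_i x 0 i ^+ 2).

Definition partial (V : normedModType R) (i : 'I_d) (f : 'rV[R]_d -> V) :
  'rV[R]_d -> V := fun x => 'D_(delta_mx 0 i) f x.

Fixpoint Ck_on (V : normedModType R) (k : nat) (U : set 'rV[R]_d)
    (f : 'rV[R]_d -> V) : Prop :=
  (forall x, U x -> {for x, continuous f}) /\
  if k is k'.+1 then
    forall i, (forall x, U x -> derivable f x (delta_mx 0 i)) /\
              Ck_on k' U (partial i f)
  else True.

Definition laplacian (V : normedModType R) (f : 'rV[R]_d -> V) x : V :=
  \sum_i partial i (partial i f) x.

Definition harmonic_on (V : normedModType R) (U : set 'rV[R]_d)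
    (f : 'rV[R]_d -> V) : Prop :=
  Ck_on 2 U f /\ forall x, U x -> laplacian f x = 0.

(* [mderiv] is the formal derivative; [homog_harmonic m 0] holds for all m. *)
Definition homog_harmonic (m : nat) (p : mpoly d R) : Prop :=
  p \is ishomog1 m mdeg /\ \sum_i mderiv i (mderiv i p) = 0.

Definition peval (p : mpoly d R) (x : 'rV[R]_d) : R := meval (x 0) p.

End Euclidean.

Definition dbar (R : realType) (n : nat) (f : 'rV[R]_n.+1 -> clifford R n) x :
    clifford R n :=
  partial ord0 f x + \sum_(i < n) clgen R i * partial (lift ord0 i) f x.

Definition kelvin (R : realType) (V : normedModType R) (f : 'rV[R]_4 -> V)
    (x : 'rV[R]_4) : V :=
  enorm x ^- 2 *: f (enorm x ^- 2 *: x).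

Section Zonal.
Variable R : realType.

(* Hyperspherical coordinates on the unit sphere of R^4. *)
Definition spherical (u : 'rV[R]_3) : 'rV[R]_4 :=
  let psi := u 0 0 in let theta := u 0 1 in let phi := u 0 2 in
  \row_(k < 4) [:: cos psi;
                   sin psi * cos theta;
                   sin psi * sin theta * cos phi;
                   sin psi * sin theta * sin phi]`_k.

(* Square root of the Gram determinant of the tangent vectors of the chart. *)
Definition area_density (u : 'rV[R]_3) : R :=
  let J := \matrix_(j < 3, k < 4) partial j (fun v => spherical v 0 k) u in
  Num.sqrt (\det (J *m J^T)).

Definition surface_integral (f : 'rV[R]_4 -> R) : R :=
  Rintegral ((lebesgue_measure \x lebesgue_measure) \x lebesgue_measure)%E
    ((`[0, pi] `*` `[0, pi]) `*` `[0, 2 * pi])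
    (fun t : R * R * R =>
       let u := \row_(j < 3) [:: t.1.1; t.1.2; t.2]`_j in
       f (spherical u) * area_density u).

(* Integral against the surface measure normalized to total mass 1. *)
Definition sphere_mean (f : 'rV[R]_4 -> R) : R :=
  surface_integral f / surface_integral (cst 1).

Definition is_zonal (m : nat) (a : 'rV[R]_4) (Z : mpoly 4 R) : Prop :=
  homog_harmonic m Z /\
  forall p, homog_harmonic m p ->
    peval p a = sphere_mean (fun z => peval p z * peval Z z).

(* [unique] makes this the polynomial determined by its reproducing property;
   if there were none, or several, it would be 0. *)
Definition zonal (m : nat) (a : 'rV[R]_4) : 'rV[R]_4 -> R :=
  peval (xget 0 [set Z | unique (is_zonal m a) Z]).

Definition pole1 : 'rV[R]_4 := delta_mx 0 0.

(* k C_k = 2 (k + l - 1) t C_(k-1) - (k + 2 l - 2) C_(k-2). *)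
Fixpoint gegenbauer (l : R) (k : nat) : {poly R} :=
  match k with
  | 0 => 1
  | 1 => (2 * l) *: 'X
  | (k''.+1 as k').+1 =>
      k%:R^-1 *: ((2 * (k%:R + l - 1)) *: ('X * gegenbauer l k')
                  - (k%:R + 2 * l - 2) *: gegenbauer l k'')
  end.

End Zonal.

(* Main.v *)
Require Import Defs.
From HB Require Import structures.
From mathcomp Require Import all_boot all_order all_algebra.
From mathcomp Require Import all_classical all_reals all_analysis.
From mathcomp Require Import ring zify measurable_realfun.
From mathcomp Require Import -(notations) mpoly.

(** All the functions of the statement are instances of one polynomial in two
variables. If s = y + y^c and N = y y^c are real, then y and y^c commute and
are the roots of T^2 - s T + N, so that the divided difference
(y^m - (y^c)^m) / (y - y^c) is the Lucas polynomial U_m(s, N), where U_0 = 0,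
U_1 = 1 and U_(m+2) = s U_(m+1) - N U_m ([quadratic_sum]). Hence (x^m)'_s is
U_m(s, N) on the quadratic cone, at real points too by continuity
([sph_deriv_pow]), and (x^-m)'_s is - U_m(s, N) / N^m because y^-1 = y^c / N
([sph_deriv_powN]). For y = x a^c with x, a in R^4 one has s = 2 <x, a> and
N = |x|^2 |a|^2 ([pv_conj_quadratic]). The formula with the Kelvin transform is
then the homogeneity of U_m, and part (d) holds because U_(k+1)(2 t, 1) and the
Gegenbauer polynomial of parameter 1 obey the same recurrence.

For dbar, the derivative of x^m in the direction e_i is the sum of the
x^(m-1-k) e_i x^k, and in dimension four the sum of the e_i w e_i, with
e_0 = 1, is - 2 w^c for every power w of a paravector ([sandwich_pow]); what
remains is - 2 U_m(s, N).

It remains to see that, for |a| = 1, the zonal harmonic of degree k is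
(k + 1) U_(k+1)(2 <x, a>, |x|^2). This polynomial is harmonic by induction on k,
together with the formula for its derivative along a ([lapl_lucas]). Its
reproducing property rests on a single identity for the mean M over the sphere:
(k + 3) M(x_i p) = M(d_i p) for p homogeneous of degree k ([mean_divergence]).
It is the divergence theorem in the ball, and it is proved here on monomials,
for which spherical coordinates turn the integral into a product of integrals
of cos^a sin^b. The identity implies that a harmonic H of degree k is
orthogonal to all polynomials of smaller degree, and that
2^k (k + 1) M(H <., a>^k) = H(a) ([harmonic_linform_moment]); as U_(k+1) is
(2 <x, a>)^k modulo |x|^2, and |x|^2 = 1 on the sphere, the reproducing property
follows. The kernel is unique, since two reproducing kernels can be tested
against each other ([is_zonal_unique]).

Finally (x^-m)'_s is a harmonic polynomial of degree m - 1 divided by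
|x|^(2 m), and such quotients are harmonic in R^4 ([rational_harmonic]). *)

Set Implicit Arguments.
Unset Strict Implicit.
Unset Printing Implicit Defensive.

Import Order.TTheory GRing.Theory Num.Theory.
Import numFieldNormedType.Exports.

Local Open Scope classical_set_scope.
Local Open Scope ring_scope.

(** * Lucas polynomials *)

(** The Lucas sequence of parameters s and N: if s = u + v and N = u v, then
(u - v) U_m(s, N) = u^m - v^m. *)
Fixpoint lucas (A : pzRingType) (s N : A) (m : nat) : A :=
  match m with
  | 0 => 0
  | 1 => 1
  | (m''.+1 as m').+1 => s * lucas s N m' - N * lucas s N m''
  end.

Lemma nat_ind2 (P : nat -> Prop) :
  P 0 -> P 1 -> (forall m, P m -> P m.+1 -> P m.+2) -> forall m, P m.
Proof.
move=> P0 P1 PS m; suff [] : P m /\ P m.+1 by [].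
by elim: m => // m [Pm PSm]; split => //; exact: PS.
Qed.

Lemma lucasSS (A : pzRingType) (s N : A) m :
  lucas s N m.+2 = s * lucas s N m.+1 - N * lucas s N m.
Proof. by []. Qed.

Lemma rmorph_lucas (A B : pzRingType) (f : {rmorphism A -> B}) s N m :
  f (lucas s N m) = lucas (f s) (f N) m.
Proof.
elim/nat_ind2: m => [||m IH0 IH1]; rewrite ?rmorph0 ?rmorph1 //.
by rewrite !lucasSS rmorphB !rmorphM IH0 IH1.
Qed.

Lemma lucas_scale (A : comPzRingType) (c s N : A) m :
  lucas (c * s) (c ^+ 2 * N) m.+1 = c ^+ m * lucas s N m.+1.
Proof.
elim/nat_ind2: m => [||m IH0 IH1]; first by rewrite /= mulr1.
  by rewrite /= !mulr1 !mulr0 !subr0.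
rewrite lucasSS IH1 IH0 [in RHS]lucasSS !exprS; ring.
Qed.

Lemma gegenbauer1_lucas (R : realType) k (t : R) :
  (gegenbauer 1 k).[t] = lucas (2 * t) 1 k.+1.
Proof.
elim/nat_ind2: k => [||k IH0 IH1].
- by rewrite /= hornerC.
- by rewrite /= !hornerE; ring.
rewrite lucasSS -IH0 -IH1.
have -> : gegenbauer 1 k.+2 = k.+2%:R^-1 *: ((2 * (k.+2%:R + 1 - 1)) *: ('X * gegenbauer 1 k.+1)
   - (k.+2%:R + 2 * 1 - 2) *: gegenbauer 1 k) :> {poly R} by [].
rewrite hornerZ hornerD hornerN !hornerZ hornerM hornerX.
have k0 : k.+2%:R != 0 :> R by rewrite pnatr_eq0.
by field.
Qed.

(** * Quadratic elements of a Clifford algebra *)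

Section QuadraticElements.
Variables (R : realType) (n : nat).
Local Notation cl := (clifford R n).
Implicit Types (x y z : cl) (s N k t : R).

Lemma clconjD x y : clconj (x + y) = clconj x + clconj y.
Proof. by have := clconj_is_linear 1 x y; rewrite !scale1r. Qed.

Lemma clconjZ k x : clconj (k *: x) = k *: clconj x.
Proof.
apply: clifford_eqP => A; rewrite !(clcoefZ, clcoef_conj); ring.
Qed.

Lemma clconjK : involutive (@clconj R n).
Proof.
move=> x; apply: clifford_eqP => A.
by rewrite !clcoef_conj mulrA clsign_sq mul1r.
Qed.

Lemma clcoef_alg k A : clcoef (k%:A : cl) A = k * (A == finset.set0)%:R.
Proof. by rewrite clcoefZ clcoefB. Qed.

Lemma clscal_alg k : clscal (k%:A : cl) = k.
Proof. by rewrite /clscal clcoef_alg eqxx mulr1. Qed.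

Lemma clconj_alg k : clconj (k%:A : cl) = k%:A.
Proof.
apply: clifford_eqP => A; rewrite clcoef_conj clcoef_alg.
by case: eqP => [->|_]; rewrite ?clsign0l ?mul1r ?mulr0.
Qed.

Lemma alg_comm k x : k%:A * x = x * k%:A.
Proof. by rewrite mulr_algl mulr_algr. Qed.

Lemma clscal_normsq x : clscal (x * clconj x) = \sum_A clcoef x A ^+ 2.
Proof.
rewrite /clscal clcoefM; apply: eq_bigr => A _; rewrite symdiff0 clcoef_conj.
by rewrite -[RHS]mul1r -[in RHS](clsign_sq R A A); ring.
Qed.

(** Trace and norm of an element of the quadratic cone. In contrast to the
definition of the cone, no imaginary unit has to be chosen. *)
Definition quadratic y s N := y + clconj y = s%:A /\ y * clconj y = N%:A.

Lemma quadratic_inv y s N : quadratic y s N ->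
  s = 2 * clscal y /\ N = \sum_A clcoef y A ^+ 2.
Proof.
move=> [hs hN]; split; last by rewrite -clscal_normsq hN clscal_alg.
rewrite -[s]clscal_alg -hs /clscal clcoefD clcoef_conj clsign0l; ring.
Qed.

Lemma quadratic_conjE y s N : quadratic y s N -> clconj y = s%:A - y.
Proof. by move=> [<- _]; rewrite addrC addKr. Qed.

Lemma quadratic_comm y s N : quadratic y s N -> GRing.comm y (clconj y).
Proof.
move=> /quadratic_conjE ->; rewrite /GRing.comm mulrBr mulrBl.
by rewrite -alg_comm.
Qed.

Lemma quadratic_conj y s N : quadratic y s N -> quadratic (clconj y) s N.
Proof.
move=> q; have [h1 h2] := q.
by split; rewrite clconjK; [rewrite addrC | rewrite -(quadratic_comm q)].
Qed.

(** Since y and y^c commute, the left-hand sides S_m satisfy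
S_(m+2) = (y + y^c) S_(m+1) - (y y^c) S_m, which is the Lucas recurrence. *)
Lemma quadratic_sum y s N m : quadratic y s N ->
  \sum_(k < m) y ^+ (m.-1 - k) * clconj y ^+ k = (lucas s N m)%:A.
Proof.
move=> q; have [hs hN] := q; have cy := quadratic_comm q.
pose S m := \sum_(k < m) y ^+ (m.-1 - k) * clconj y ^+ k.
have SS i : S i.+1 = y * S i + clconj y ^+ i.
  rewrite /S big_ord_recr /= subnn expr0 mul1r; congr (_ + _).
  rewrite mulr_sumr; apply: eq_bigr => k _; rewrite mulrA -exprS.
  congr (_ ^+ _ * _); case: i k => [[]//|i] [k ki] /=.
  by rewrite subSn.
elim/nat_ind2: m => [||m IH0 IH1].
- by rewrite big_ord0 scale0r.
- by rewrite big_ord1 /= !expr0 mulr1 scale1r.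
rewrite -!/(S _) in IH0 IH1 *.
rewrite lucasSS scalerBl -!scalerA -IH0 -IH1 -[X in X - _]mulr_algl -hs.
rewrite -[X in _ - X]mulr_algl -hN SS mulrDl -addrA; congr (_ + _).
by rewrite SS mulrDr cy !mulrA -exprS addrC addKr.
Qed.

(** The equation y^2 = s y - N, multiplied by a power of y. *)
Lemma quadratic_expr_rec y s N m : quadratic y s N ->
  y ^+ m.+2 = s *: y ^+ m.+1 - N *: y ^+ m.
Proof.
move=> q; have [_ hN] := q; have cy := quadratic_conjE q.
have -> : y ^+ m.+2 = y ^+ 2 * y ^+ m by rewrite -exprD add2n.
have -> : y ^+ 2 = s *: y - N%:A.
  by rewrite -hN cy mulrBr -mulr_algr opprB addrC subrK expr2.
by rewrite mulrBl -scalerAl -exprS mulr_algl.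
Qed.

Lemma quadratic_inverse y s N : quadratic y s N -> N != 0 ->
  y^-1 = N^-1 *: clconj y.
Proof.
move=> q N0; have [_ hN] := q.
have h : y * (N^-1 *: clconj y) = 1 by rewrite -scalerAr hN scalerA mulVf ?scale1r.
have h' : (N^-1 *: clconj y) * y = 1.
  by rewrite -scalerAl -(quadratic_comm q) hN scalerA mulVf ?scale1r.
have yu : y \is a GRing.unit by apply/unitrP; exists (N^-1 *: clconj y).
by apply: (mulrI yu); rewrite h divrr.
Qed.

Lemma clRe_quadratic y s N : quadratic y s N -> clRe y = (s / 2)%:A.
Proof. by move=> [hs _]; rewrite /clRe hs scalerA mulrC. Qed.

Lemma clIm_sq y s N : quadratic y s N ->
  clIm y * clIm y = (s ^+ 2 / 4 - N)%:A.
Proof.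
move=> q; have [hs hN] := q; have cy := quadratic_comm q.
have -> : (s ^+ 2 / 4 - N)%:A = 4^-1 *: ((s ^+ 2)%:A - (4 * N)%:A) :> cl.
  by rewrite scalerBr !scalerA -scalerBl; congr (_ *: _); field.
rewrite /clIm -scalerAl -scalerAr scalerA.
congr (_ *: _); first by field.
have -> : (s ^+ 2)%:A = s%:A * s%:A :> cl.
  by rewrite mulr_algl scalerA expr2.
rewrite -scalerA -hN -hs !(mulrDl, mulrDr, mulrBl, mulrBr, mulrN, mulNr) -!cy.
set a := y * y; set b := y * clconj y; set c := clconj y * clconj y.
by apply: clifford_eqP => A; rewrite /clcoef !mxE; ring.
Qed.

Lemma clIm_conj y : clconj (clIm y) = - clIm y.
Proof.
rewrite /clIm clconjZ clconjD -(scaleN1r (clconj y)) clconjZ clconjK !scaleN1r.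
by rewrite -scalerN opprB.
Qed.

(** The discriminant N - s^2 / 4 is the squared length of the imaginary part;
this makes it nonnegative, and positive off the real axis. *)
Lemma clIm_normsq y s N : quadratic y s N ->
  \sum_A clcoef (clIm y) A ^+ 2 = N - s ^+ 2 / 4.
Proof.
move=> q; rewrite -clscal_normsq clIm_conj mulrN (clIm_sq q).
by rewrite -scaleNr opprB clscal_alg.
Qed.

Lemma clnorm_clIm_sq y s N : quadratic y s N ->
  clnorm (clIm y) ^+ 2 = N - s ^+ 2 / 4.
Proof.
move=> q; rewrite -(clIm_normsq q) sqr_sqrtr // sumr_ge0 // => A _; exact: sqr_ge0.
Qed.

Lemma clIm_eq0 y s N : quadratic y s N -> N - s ^+ 2 / 4 = 0 -> clIm y = 0.
Proof.
move=> q; rewrite -(clIm_normsq q) => /eqP; rewrite psumr_eq0 => [|A _]; last first.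
  exact: sqr_ge0.
move=> /allP h; apply: clifford_eqP => A; have := h A (mem_index_enum A).
by rewrite sqrf_eq0 => /eqP ->; rewrite /clcoef mxE.
Qed.

Lemma quadratic_real y s N : quadratic y s N ->
  (y \in @clreals R n) = (N - s ^+ 2 / 4 == 0).
Proof.
move=> q; apply/idP/eqP => [/set_mem [t _ yt]|/(clIm_eq0 q)/eqP].
  have [-> ->] := quadratic_inv q; rewrite -yt clscal_alg.
  rewrite -clscal_normsq clconj_alg mulr_algl scalerA clscal_alg.
  by field.
rewrite scaler_eq0 invr_eq0 pnatr_eq0 /= (quadratic_conjE q) subr_eq0.
move=> /eqP ys; apply/mem_set; exists (s / 2) => //.
have : 2 *: y = s%:A by rewrite scaler_nat mulr2n {2}ys addrC subrK.
by move=> /(congr1 (fun z => 2^-1 *: z)); rewrite !scalerA mulVf ?pnatr_eq0 //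
  scale1r mulrC => ->.
Qed.

Lemma quadratic_gt0 y s N : quadratic y s N -> y \notin @clreals R n ->
  0 < N - s ^+ 2 / 4.
Proof.
move=> q; rewrite (quadratic_real q) lt_neqAle eq_sym => -> /=.
by rewrite -(clIm_normsq q) sumr_ge0 // => A _; exact: sqr_ge0.
Qed.

Lemma clIm_unit y s N : quadratic y s N -> y \notin @clreals R n ->
  clIm y \is a GRing.unit.
Proof.
move=> q /(quadratic_gt0 q) D0; apply/unitrP.
exists ((s ^+ 2 / 4 - N)^-1 *: clIm y).
have D : s ^+ 2 / 4 - N != 0 by rewrite -opprB oppr_eq0 gt_eqF.
have II c : c *: (clIm y * clIm y) = (c * (s ^+ 2 / 4 - N))%:A.
  by rewrite (clIm_sq q) scalerA.
by split; [rewrite -(scalerAl _ (clIm y) (clIm y))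
  |rewrite -(scalerAr _ (clIm y) (clIm y))]; rewrite II mulVf ?scale1r.
Qed.

Lemma clgen_imag_unit i : imag_units (clgen R i : cl).
Proof.
split; rewrite clconj_gen ?subrr // mulrN.
have := clgen_anticomm R i i; rewrite eqxx mulr1 -mulr2n -scaler_nat => h.
have := congr1 (fun z => - (2^-1 *: z)) h.
by rewrite scalerA mulVf ?pnatr_eq0 // scale1r scalerN opprK scalerA mulVf
  ?pnatr_eq0 // scale1r.
Qed.

Lemma clgen_sq i : clgen R i * clgen R i = -1 :> cl.
Proof.
have [_] := clgen_imag_unit i; rewrite clconj_gen mulrN => <-.
by rewrite opprK.
Qed.

Lemma imag_unit_quadratic (J : cl) c t : imag_units J ->
  quadratic (c%:A + t *: J) (2 * c) (c ^+ 2 + t ^+ 2).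
Proof.
move=> [hJ JJ]; have Jc : clconj J = - J by apply/eqP; rewrite -addr_eq0 addrC hJ.
rewrite /quadratic clconjD clconj_alg clconjZ Jc scalerN; split.
  by rewrite addrACA subrr addr0 -scalerDl; congr (_ *: _); ring.
move: JJ; rewrite Jc mulrN => JJ.
rewrite mulrDl !mulrBr !mulr_algl -scalerAl mulr_algr -!scalerAl -!scalerAr.
rewrite -[J * J]opprK JJ !scalerN opprK !scalerA.
rewrite -!expr2 scalerDl [c * t]mulrC addrA subrK //.
Qed.

Lemma quad_cone_quadratic (z : cl) : quad_cone z -> exists s N, quadratic z s N.
Proof.
move=> [J Ju [c [t ->]]]; exists (2 * c), (c ^+ 2 + t ^+ 2).
exact: imag_unit_quadratic.
Qed.

End QuadraticElements.

(** * Spherical derivatives of the powers *)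

Section DifferenceQuotient.
Variables (R : realType) (n : nat).
Local Notation cl := (clifford R n).
Implicit Types (y : cl) (s N : R).

(** The value of [sph_deriv] at the points that are not real. *)
Definition sph_quot (f : cl -> cl) y :=
  2^-1 *: ((clIm y)^-1 * (f y - f (clconj y))).

Lemma sph_quot_pow y s N m : quadratic y s N -> y \notin @clreals R n ->
  sph_quot (fun z => z ^+ m) y = (lucas s N m)%:A.
Proof.
move=> q ny; rewrite -(quadratic_sum m q) /sph_quot.
rewrite subrXX_comm; last exact: quadratic_comm q.
have -> : y - clconj y = 2 *: clIm y.
  by rewrite scalerA divff ?pnatr_eq0 // scale1r.
rewrite -scalerAl -scalerAr scalerA mulVf ?pnatr_eq0 // scale1r.
by rewrite mulrA mulVr ?mul1r ?(clIm_unit q).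
Qed.

(** As y^-1 = y^c / N, this is the quotient for z^m with y and y^c exchanged,
which explains the sign. *)
Lemma sph_quot_powN y s N m : quadratic y s N -> y \notin @clreals R n ->
  sph_quot (fun z => z ^- m) y = (- lucas s N m / N ^+ m)%:A.
Proof.
move=> q ny; have N0 : N != 0.
  rewrite gt_eqF //; have := quadratic_gt0 q ny; rewrite subr_gt0.
  by apply: le_lt_trans; rewrite divr_ge0 ?sqr_ge0.
have := sph_quot_pow m q ny; rewrite /sph_quot -!exprVn.
rewrite (quadratic_inverse q) // (quadratic_inverse (quadratic_conj q)) // clconjK.
rewrite !exprZn exprVn -scalerBr => h.
set w := (clIm y)^-1 in h *; set d := _ - _ in h.
have -> : clconj y ^+ m - y ^+ m = - d by rewrite opprB.
rewrite -(scalerAr _ w) mulrN !scalerN scalerA mulrC -(scalerA _ _ (w * d)) h.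
by rewrite scalerA -scaleNr; congr (_ *: _); ring.
Qed.

Lemma clcoef_continuous A : continuous (fun x : cl => clcoef x A).
Proof. by move=> x; exact: coord_continuous. Qed.

Lemma lucas_cvg (T : Type) (F : set_system T) {FF : Filter F} (u v : T -> R) (s N : R) m :
  u @ F --> s -> v @ F --> N -> (fun t => lucas (u t) (v t) m) @ F --> lucas s N m.
Proof.
move=> us vN; elim/nat_ind2: m => [||m IH0 IH1]; try exact: cvg_cst.
by rewrite lucasSS; under eq_fun do rewrite lucasSS; apply: cvgB; exact: cvgM.
Qed.

Lemma quadratic_coord_cvg (y : cl) s N : quadratic y s N ->
  (fun z : cl => 2 * clscal z) @ y --> s /\
  (fun z : cl => \sum_A clcoef z A ^+ 2) @ y --> N.
Proof.
have FF : Filter (nbhs y) := nbhs_filter y.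
have c A : (fun z : cl => clcoef z A) @ nbhs y --> clcoef y A.
  exact: clcoef_continuous.
move=> /quadratic_inv[-> ->]; split.
  by apply: (cvgM (F := nbhs y)); [exact: cvg_cst | exact: c].
apply: (@cvg_big R _ +%R 0 _ _ _ (nbhs y)) => [|A _]; first exact: add_continuous.
under eq_fun do rewrite expr2; rewrite expr2.
by apply: (cvgM (F := nbhs y)); exact: c.
Qed.

End DifferenceQuotient.

Section SphericalDerivative.
Variables (R : realType) (n : nat).
Local Notation cl := (clifford R n.+1).

(** This makes the limit that defines the spherical derivative at a real
point c one along a proper filter: c + t e_0 tends to c with t. *)
Lemma closure_cone_nonreal (y : cl) : y \in @clreals R n.+1 ->
  closure (@quad_cone R n.+1 `\` @clreals R n.+1) y.
Proof.
move=> /set_mem[c _ <-] B nB; pose J : cl := clgen R ord0.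
have cv : (fun t : R => c%:A + t *: J) @ 0^' --> (c%:A : cl).
  have -> : nbhs (c%:A : cl) = nbhs (c%:A + (0 : R) *: J : cl).
    by rewrite scale0r addr0.
  apply: cvg_trans (cvg_app _ (@nbhs_dnbhs _ _)) _.
  apply: cvgD; first exact: cvg_cst.
  by apply: cvgZr_tmp; exact: cvg_id.
have : \forall t \near (0 : R)^', (t != 0 :> R) /\ B (c%:A + t *: J).
  near=> t; split; first by near: t; exact: nbhs_dnbhs_neq.
  by near: t; exact: cv.
move=> /(@filter_ex _ _ (Proper_dnbhs_numFieldType (0 : R)))[t [t0 Bt]].
exists (c%:A + t *: J); split => //.
have Ju : imag_units J := clgen_imag_unit R ord0.
split; first by exists J => //; exists c, t.
move/mem_set; rewrite (quadratic_real (imag_unit_quadratic c t Ju)).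
have -> : c ^+ 2 + t ^+ 2 - (2 * c) ^+ 2 / 4 = t ^+ 2 by field.
by rewrite sqrf_eq0 (negPf t0).
Unshelve. all: by end_near. Qed.

(** A difference quotient that is a function g of the trace and of the norm
extends to real points: trace and norm are polynomials in the coordinates
([quadratic_inv]), so that g need only be continuous. *)
Lemma sph_deriv_cone (f : cl -> cl) (g : R -> R -> R) y s N :
  (forall z s N, quadratic z s N -> z \notin @clreals R n.+1 ->
     sph_quot f z = (g s N)%:A) ->
  (fun z : cl => g (2 * clscal z) (\sum_A clcoef z A ^+ 2)) @ y --> g s N ->
  quadratic y s N -> sph_deriv f y = (g s N)%:A.
Proof.
move=> fg gy q; rewrite /sph_deriv; case: ifPn => [yr|]; last exact: fg.
have W := within_nbhs_proper (closure_cone_nonreal yr).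
apply: cvg_lim => //.
have gc : (fun z : cl => (g (2 * clscal z) (\sum_A clcoef z A ^+ 2))%:A : cl) @ y
    --> ((g s N)%:A : cl).
  exact: (@cvgZr_tmp _ _ _ (nbhs y) (nbhs_filter y) _ _ _ gy).
apply: cvg_trans (cvg_within_filter _ gc); apply: near_eq_cvg.
apply: filterS (near_withinT _ _) => z [/quad_cone_quadratic[s' [N' q']] nz].
rewrite -/(sph_quot f z) (fg z s' N') //; last by apply/negP => /set_mem.
by have [-> ->] := quadratic_inv q'.
Qed.

Lemma sph_deriv_pow m (y : cl) s N : quadratic y s N ->
  sph_deriv (fun z => z ^+ m) y = (lucas s N m)%:A.
Proof.
move=> q; have [c1 c2] := quadratic_coord_cvg q.
apply: (@sph_deriv_cone _ (fun s N => lucas s N m)) q => [z s' N'|].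
  exact: sph_quot_pow.
exact: (lucas_cvg (FF := nbhs_filter y)).
Qed.

Lemma sph_deriv_powN m (y : cl) s N : quadratic y s N -> N != 0 ->
  sph_deriv (fun z => z ^- m) y = (- lucas s N m / N ^+ m)%:A.
Proof.
move=> q N0; have [c1 c2] := quadratic_coord_cvg q.
apply: (@sph_deriv_cone _ (fun s N => - lucas s N m / N ^+ m)) q => [z s' N'|].
  exact: sph_quot_powN.
apply: (cvgM (F := nbhs y)).
  by apply: (cvgN (F := nbhs y)); exact: (lucas_cvg (FF := nbhs_filter y)).
apply: (cvgV (F := nbhs y)); first by rewrite expf_neq0.
have h := @exprn_continuous R m N; exact: (cvg_comp (G := nbhs N) _ _ c2 h).
Qed.

End SphericalDerivative.

(** * Paravectors *)

Section DotProduct.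
Variables (R : realType) (d : nat).
Implicit Types (x y a : 'rV[R]_d) (c : R).

Definition dotv x a : R := \sum_i x 0 i * a 0 i.

Lemma enorm_dotv x : enorm x ^+ 2 = dotv x x.
Proof.
rewrite /enorm sqr_sqrtr; first by apply: eq_bigr => i _; rewrite expr2.
by rewrite sumr_ge0 // => i _; rewrite sqr_ge0.
Qed.

Lemma dotvDl x y a : dotv (x + y) a = dotv x a + dotv y a.
Proof. by rewrite -big_split; apply: eq_bigr => i _; rewrite mxE mulrDl. Qed.

Lemma dotvC x a : dotv x a = dotv a x.
Proof. by apply: eq_bigr => i _; rewrite mulrC. Qed.

Lemma dotvZ c x : dotv (c *: x) (c *: x) = c ^+ 2 * dotv x x.
Proof.
by rewrite /dotv mulr_sumr; apply: eq_bigr => i _; rewrite !mxE; ring.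
Qed.

Lemma dotv_eq0 x : (dotv x x == 0) = (x == 0).
Proof.
apply/eqP/eqP => [/eqP|->]; last by rewrite /dotv big1 // => i _; rewrite mxE mul0r.
rewrite psumr_eq0 => [/allP h|i _]; last by rewrite -expr2 sqr_ge0.
apply/rowP => i; have := h i (mem_index_enum i).
by rewrite mulf_eq0 orbb mxE => /eqP.
Qed.

End DotProduct.

Section Paravectors.
Variables (R : realType) (n : nat).
Local Notation cl := (clifford R n).
Local Notation pv := (@paravector R n).
Implicit Types x a : 'rV[R]_n.+1.

Lemma paravectorD x a : pv (x + a) = pv x + pv a.
Proof.
rewrite /paravector mxE scalerDl addrACA; congr (_ + _).
by rewrite -big_split; apply: eq_bigr => i _; rewrite mxE scalerDl.
Qed.

Lemma paravectorZ c x : pv (c *: x) = c *: pv x.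
Proof.
rewrite /paravector mxE scalerDr scalerA scaler_sumr; congr (_ + _).
by apply: eq_bigr => i _; rewrite mxE scalerA.
Qed.

Lemma paravector_delta0 : pv (delta_mx 0 ord0) = 1.
Proof.
rewrite /paravector mxE !eqxx scale1r big1 ?addr0 // => i _.
by rewrite mxE eq_sym (negPf (neq_lift _ _)) andbF scale0r.
Qed.

Lemma paravector_delta i : pv (delta_mx 0 (lift ord0 i)) = clgen R i.
Proof.
rewrite /paravector mxE (negPf (neq_lift _ _)) andbF scale0r add0r (bigD1 i) //=.
rewrite mxE !eqxx scale1r big1 ?addr0 // => j ji.
by rewrite mxE (inj_eq lift_inj) (negPf ji) andbF scale0r.
Qed.

Lemma clconj_pv x : clconj (pv x) = (2 * x 0 0)%:A - pv x.
Proof.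
rewrite /paravector clconjD clconj_alg opprD addrA -scalerBl.
congr (_ *: _ + _); first by ring.
have c0 : clconj 0 = 0 :> cl by rewrite -[0](scale0r (1 : cl)) clconj_alg.
rewrite (big_morph _ (@clconjD R n) c0) -sumrN; apply: eq_bigr => i _.
by rewrite clconjZ clconj_gen scalerN.
Qed.

(** The square of the imaginary part v is minus the sum of the squares of its
coordinates, because the mixed products anticommute. *)
Lemma pv_normsq x : pv x * clconj (pv x) = (dotv x x)%:A.
Proof.
rewrite clconj_pv /paravector.
set v := \sum_(i < n) _; set c := x 0 0.
have -> : (2 * c)%:A - (c%:A + v) = c%:A - v.
  by rewrite opprD addrA -scalerBl; congr (_ *: _ + _); ring.
have ZM k l (u w : cl) : (k *: u) * (l *: w) = (k * l) *: (u * w).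
  by rewrite -scalerAl -scalerAr scalerA.
have vv : v * v = (- \sum_(i < n) x 0 (lift ord0 i) ^+ 2)%:A.
  apply: (@scalerI _ _ (2 : R)); first by rewrite pnatr_eq0.
  rewrite scaler_nat mulr2n {1 2}/v mulr_suml.
  under eq_bigr do rewrite mulr_sumr.
  rewrite [X in _ + X]exchange_big -big_split /= scalerA mulrN mulr_sumr -sumrN.
  rewrite scaler_suml; apply: eq_bigr => i _.
  rewrite -big_split (bigD1 i) //= big1 ?addr0 => [|j ji].
    rewrite ZM -scalerDr clgen_anticomm eqxx.
    by rewrite -(scaleNr (2 * 1)) scalerA; congr (_ *: _); ring.
  rewrite !ZM [X in _ + X *: _]mulrC -scalerDr.
  by rewrite clgen_anticomm eq_sym (negPf ji) mulr0 scale0r oppr0 scaler0.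
rewrite mulrDl !mulrBr (alg_comm c v) addrA subrK vv mulr_algl scalerA.
rewrite -scaleNr opprK -scalerDl; congr (_ *: _); rewrite /dotv big_ord_recl.
by congr (_ + _); apply: eq_bigr => i _; rewrite expr2.
Qed.

Lemma pv_quadratic x : quadratic (pv x) (2 * x 0 0) (dotv x x).
Proof. by split; [rewrite clconj_pv addrC subrK | exact: pv_normsq]. Qed.

(** The trace is obtained by polarizing [pv_normsq], and the norm from the
fact that a^c a = a a^c is real. *)
Lemma pv_conj_quadratic x a :
  quadratic (pv x * clconj (pv a)) (2 * dotv x a) (dotv x x * dotv a a).
Proof.
split; rewrite clconjM clconjK.
  have := pv_normsq (x + a).
  rewrite paravectorD clconjD mulrDl !mulrDr !pv_normsq.
  rewrite !(dotvDl, dotvC _ (x + a)) [dotv a x]dotvC => h.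
  have -> : (2 * dotv x a)%:A = (dotv x x + dotv x a + (dotv x a + dotv a a))%:A
    - (dotv x x)%:A - (dotv a a)%:A :> cl.
    by rewrite -!scalerBl; congr (_ *: _); ring.
  rewrite -h addrACA [(dotv x x)%:A + _]addrC.
  by rewrite -!addrA [_ + (_ - _)]addrC;
   apply: clifford_eqP => A; rewrite /clcoef !mxE; ring.
rewrite mulrA -[_ * clconj (pv a) * _]mulrA -(quadratic_comm (pv_quadratic a)).
by rewrite pv_normsq mulr_algr -scalerAl pv_normsq scalerA mulrC.
Qed.

(** Real part and length of the imaginary part determine trace and norm. *)
Lemma same_re_im_quadratic (y : cl) (w : 'rV[R]_n.+1) s N :
  quadratic y s N -> same_re_im y w -> s = 2 * w 0 0 /\ N = dotv w w.
Proof.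
move=> q [re im]; have qw := pv_quadratic w.
have sE : s = 2 * w 0 0.
  move: re; rewrite (clRe_quadratic q) (clRe_quadratic qw) => /(congr1 (@clscal R n)).
  rewrite !clscal_alg => /(congr1 (fun t => t * 2)).
  by rewrite !divfK ?pnatr_eq0.
split => //; have := congr1 (fun t => t ^+ 2) im.
rewrite (clnorm_clIm_sq q) (clnorm_clIm_sq qw) sE => /eqP.
by rewrite (inj_eq (addIr _)) => /eqP.
Qed.

End Paravectors.

(** * The operator dbar on the powers *)

Section PowerDerivative.
Variables (R : realType) (n : nat).
Local Notation cl := (clifford R n).
Local Notation pv := (@paravector R n).
Implicit Types (u v w : cl) (x : 'rV[R]_n.+1).

Lemma clmul_cvg (T : Type) (F : set_system T) {FF : Filter F} (f g : T -> cl) u v :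
  f @ F --> u -> g @ F --> v -> (fun t => f t * g t) @ F --> u * v.
Proof.
move=> fu gv.
have c (h : T -> cl) w A : h @ F --> w -> (fun t => clcoef (h t) A) @ F --> clcoef w A.
  by move=> hw; exact: (cvg_comp _ _ hw (@clcoef_continuous R n A w)).
apply: (@cvg_big cl _ +%R 0 _ _ _ F) => [|A _]; first exact: add_continuous.
apply: (@cvg_big cl _ +%R 0 _ _ _ F) => [|B _]; first exact: add_continuous.
apply: cvgZr_tmp; apply: cvgM; last exact: cvg_cst.
by apply: cvgM; exact: c.
Qed.

Lemma clexp_cvg (T : Type) (F : set_system T) {FF : Filter F} (f : T -> cl) u m :
  f @ F --> u -> (fun t => f t ^+ m) @ F --> u ^+ m.
Proof.
move=> fu; elim: m => [|m IH]; first by under eq_fun do rewrite expr0; exact: cvg_cst.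
by rewrite exprS; under eq_fun do rewrite exprS; exact: clmul_cvg.
Qed.

(** A form of u^m - v^m in which u and v are not supposed to commute. *)
Lemma expr_sub_telescope (A : pzRingType) (u v : A) m :
  u ^+ m - v ^+ m = \sum_(k < m) u ^+ (m.-1 - k) * (u - v) * v ^+ k.
Proof.
elim: m => [|m IH]; first by rewrite big_ord0 !expr0 subrr.
rewrite big_ord_recr /= subnn expr0 mul1r.
have -> : \sum_(k < m) u ^+ (m - k) * (u - v) * v ^+ k = u * (u ^+ m - v ^+ m).
  rewrite IH mulr_sumr; apply: eq_bigr => k _; rewrite !mulrA -exprS.
  congr (_ ^+ _ * _ * _); case: m k {IH} => [[]//|m] k /=.
  by rewrite -subSn // -ltnS.
by rewrite mulrBr mulrBl -!exprS addrA subrK.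
Qed.

(** The powers take values in a noncommutative algebra, whence the explicit
difference quotients. *)
Lemma paravector_pow_derive m x (v : 'rV[R]_n.+1) :
  is_derive x v (fun z => pv z ^+ m)
    (\sum_(k < m) pv x ^+ (m.-1 - k) * pv v * pv x ^+ k).
Proof.
set D := \sum_(k < m) _; set f := fun z => _.
have h : (fun t : R => t^-1 *: ((f \o shift x) (t *: v) - f x)) @ 0^' --> D.
  pose S t := \sum_(k < m) (pv x + t *: pv v) ^+ (m.-1 - k) * pv v * pv x ^+ k.
  have uc : (fun t : R => pv x + t *: pv v) @ 0^' --> pv x.
    apply: cvg_trans (cvg_app _ (@nbhs_dnbhs _ _)) _.
    rewrite -[X in _ --> X]addr0 -[X in _ + X](scale0r (pv v)).
    apply: cvgD; first exact: cvg_cst.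
    by apply: cvgZr_tmp; exact: cvg_id.
  have Sc : S @ 0^' --> D.
    apply: (@cvg_big cl _ +%R 0) => [|k _]; first exact: add_continuous.
    apply: clmul_cvg; last exact: cvg_cst.
    by apply: clmul_cvg; [exact: clexp_cvg | exact: cvg_cst].
  apply: cvg_trans Sc; apply: near_eq_cvg.
  have : \forall t \near (0 : R)^', t != 0 by exact: nbhs_dnbhs_neq.
  apply: filterS => t t0; apply/esym; rewrite /f /= paravectorD paravectorZ [t *: _ + _]addrC.
  rewrite expr_sub_telescope scaler_sumr; apply: eq_bigr => k _.
  rewrite (_ : pv x + t *: pv v - pv x = t *: pv v); last by rewrite addrAC subrr add0r.
  by rewrite -scalerAr -scalerAl scalerA mulVf // scale1r.
apply: DeriveDef; first by apply/cvg_ex; exists D.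
exact: cvg_lim.
Qed.

Lemma dbar_paravector_pow m x :
  dbar (fun z => pv z ^+ m) x =
  \sum_(k < m) (pv x ^+ (m.-1 - k) + \sum_(i < n) clgen R i * pv x ^+ (m.-1 - k) * clgen R i)
     * pv x ^+ k.
Proof.
rewrite /dbar /partial.
have [_ ->] := paravector_pow_derive m x (delta_mx 0 ord0).
under [X in _ + X]eq_bigr => i _.
  have [_ ->] := paravector_pow_derive m x (delta_mx 0 (lift ord0 i)).
  rewrite paravector_delta mulr_sumr.
  over.
rewrite paravector_delta0 [X in _ + X]exchange_big /= -big_split /=; apply: eq_bigr => k _ /=.
by rewrite mulr1 mulrDl mulr_suml; congr (_ + _); apply: eq_bigr => i _; rewrite !mulrA.
Qed.

End PowerDerivative.

Section Sandwich.
Variable R : realType.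
Local Notation cl := (clifford R 3).
Local Notation pv := (@paravector R 3).
Implicit Types (u v w : cl) (x : 'rV[R]_4).

(** The first summand is e_0 w e_0 for e_0 = 1. *)
Definition sandwich w : cl := w + \sum_(i < 3) clgen R i * w * clgen R i.

Lemma sandwichD u v : sandwich (u + v) = sandwich u + sandwich v.
Proof.
rewrite /sandwich addrACA -big_split; congr (_ + _); apply: eq_bigr => i _ /=.
by rewrite mulrDr mulrDl.
Qed.

Lemma sandwichZ c u : sandwich (c *: u) = c *: sandwich u.
Proof.
rewrite /sandwich scalerDr scaler_sumr; congr (_ + _); apply: eq_bigr => i _ /=.
by rewrite -scalerAr -scalerAl.
Qed.

Lemma sandwich1 : sandwich 1 = -2.
Proof.
rewrite /sandwich; under eq_bigr do rewrite mulr1 clgen_sq.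
rewrite !big_ord_recl big_ord0 addr0 !addrA subrr sub0r -opprD.
by congr (- _); rewrite -natr1.
Qed.

(** The product e_i e_j e_i is - e_j for i = j and e_j otherwise; the
coefficient 2 is 1 + 2 - 1 and depends on the number of generators. *)
Lemma sandwich_gen j : sandwich (clgen R j) = 2 *: clgen R j.
Proof.
have t i : clgen R i * clgen R j * clgen R i = (1 - 2 * (i == j)%:R) *: clgen R j.
  have /eqP := clgen_anticomm R i j; rewrite -subr_eq0 opprK -addrA addr_eq0 => /eqP ->.
  rewrite mulNr mulrDl -mulrA clgen_sq mulrN1 mulr_algl opprD opprK.
  case: eqP => [->|_]; rewrite ?mulr1 ?mulr0 ?scale0r ?subr0 ?scale1r //.
  by rewrite -[X in X - _]scale1r -scalerBl.
rewrite /sandwich; under eq_bigr do rewrite t.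
rewrite -scaler_suml -{1}[clgen R j]scale1r -scalerDl; congr (_ *: _).
rewrite (bigD1 j) //= (eq_bigr (fun=> 1)) => [|i /negPf ->]; last by rewrite mulr0 subr0.
have -> : \sum_(i < 3 | i != j) 1 = 2 :> R.
  by rewrite sumr_const cardC1 card_ord.
by rewrite eqxx mulr1; ring.
Qed.

Lemma sandwich_pv x : sandwich (pv x) = - 2 *: clconj (pv x).
Proof.
rewrite clconj_pv /paravector; set v := \sum_(i < 3) _.
have -> : (2 * x 0 0)%:A - ((x 0 0)%:A + v) = (x 0 0)%:A - v.
  by rewrite opprD addrA -scalerBl; congr (_ *: _ + _); ring.
have s0 : sandwich 0 = 0 by have := sandwichZ 0 1; rewrite !scale0r.
have -> : sandwich ((x 0 0)%:A + v) = x 0 0 *: (- 2) + 2 *: v.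
  rewrite sandwichD sandwichZ sandwich1; congr (_ + _).
  rewrite (big_morph _ sandwichD s0) scaler_sumr; apply: eq_bigr => i _.
  by rewrite sandwichZ sandwich_gen !scalerA mulrC.
rewrite scalerBr !scaleNr opprK scalerA mulrC -scalerA scalerN; congr (- _ + _).
by rewrite scaler_nat.
Qed.

(** Powers of x and of x^c satisfy the same linear recurrence, x and x^c having
the same trace and norm, so the exponents 0 and 1 suffice. *)
Lemma sandwich_pow x k : sandwich (pv x ^+ k) = - 2 *: clconj (pv x) ^+ k.
Proof.
have q := pv_quadratic x; have q' := quadratic_conj q.
elim/nat_ind2: k => [||k IH0 IH1].
- by rewrite !expr0 sandwich1 scaleNr scaler_nat.
- by rewrite !expr1 sandwich_pv.
rewrite (quadratic_expr_rec k q) (quadratic_expr_rec k q') -scaleNr sandwichD !sandwichZ.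
by rewrite IH0 IH1 scalerBr !scalerA -scaleNr mulrC; congr (_ + _ *: _); ring.
Qed.

Lemma dbar_pow m x : dbar (fun z => pv z ^+ m) x =
  (- 2 * lucas (2 * x 0 0) (dotv x x) m)%:A.
Proof.
have q' := quadratic_conj (pv_quadratic x).
rewrite dbar_paravector_pow -scalerA -(quadratic_sum m q') clconjK scaler_sumr.
by apply: eq_bigr => k _; rewrite -/(sandwich _) sandwich_pow -scalerAl.
Qed.

End Sandwich.

(** * Polynomial calculus *)

Section PolynomialCalculus.
Variables (R : realType) (n : nat).
Local Notation mpolyR := (mpoly n R).
Local Notation x_ i := (mpolyX R (mnm1 i)).
Local Notation homog k := (ishomog1 k mdeg).
Implicit Types (p q : mpolyR) (m : multinom n) (i : 'I_n) (a x : 'rV[R]_n).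

(** Induction along the ring operations, suited to evaluation, differentiation
and continuity. *)
Lemma mpoly_ring_ind (P : mpolyR -> Prop) :
  (forall c, P (mpolyC n c)) -> (forall i, P (x_ i)) ->
  (forall p q, P p -> P q -> P (p + q)) -> (forall p q, P p -> P q -> P (p * q)) ->
  forall p, P p.
Proof.
move=> PC PX PD PM p; rewrite [p]mpolyE; apply: big_ind => //.
  by rewrite -mpolyC0.
move=> m _; rewrite -mul_mpolyC; apply: (PM) => //.
rewrite mpolyXE_id; apply: big_ind => //; first by rewrite -mpolyC1.
by move=> i _; elim: (m i) => [|e IH]; rewrite ?expr0 -?mpolyC1 // exprS; apply: PM.
Qed.

Lemma mderivXU i j : mderiv i (x_ j) = (i == j)%:R.
Proof.
rewrite mderivX mnm1E eq_sym; case: eqP => [->|_]; last by rewrite scale0r.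
rewrite scale1r (_ : mnm_sub _ _ = mnm0) ?mpolyX0 //.
by apply/mnmP => k; rewrite mnmBE mnm0E subnn.
Qed.

Lemma dhomogXU i : x_ i \is ishomog1 1 mdeg.
Proof. by rewrite dhomogX; apply/eqP; exact: mdeg1. Qed.

Lemma dhomog_mderiv k i p : p \is ishomog1 k.+1 mdeg -> mderiv i p \is ishomog1 k mdeg.
Proof.
move=> /dhomogP hp; apply/dhomogP => m; rewrite mcoeff_msupp mcoeff_deriv => h.
have : mnm_add m (mnm1 i) \in msupp p.
  by rewrite mcoeff_msupp; apply: contraNneq h => ->; rewrite mul0rn.
by move=> /hp /=; rewrite mdegD mdeg1 addn1 => -[].
Qed.

Lemma dhomog0_const p : p \is ishomog1 0 mdeg -> p = mpolyC n (mcoeff mnm0 p).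
Proof.
move=> hp; apply/mpolyP => m; rewrite mcoeffC.
have [->|m0] := eqVneq m mnm0; first by rewrite mulr1.
by rewrite mulr0 (dhomog_nemf_coeff hp) // mdeg_eq0.
Qed.

Lemma euler k p : p \is ishomog1 k mdeg -> \sum_i x_ i * mderiv i p = k%:R *: p.
Proof.
move=> /dhomogP hp.
have xd i m : x_ i * mderiv i (mpolyX R m) = (m i)%:R *: mpolyX R m.
  rewrite mderivX -(scalerAr _ (x_ i)).
  case: (posnP (m i)) => [->|mi]; first by rewrite !scale0r.
  rewrite -mpolyXD; congr (_ *: mpolyX _ _); apply/mnmP => j.
  by rewrite mnmDE mnmBE mnm1E; case: eqP => [<-|_]; rewrite ?add0n ?subn0 // subnKC.
have E i : mderiv i p = \sum_(m <- msupp p) mcoeff m p *: mderiv i (mpolyX R m).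
  rewrite {1}[p]mpolyE (linear_sum (mderiv i)); apply: eq_bigr => m _.
  by rewrite /= mderivZ.
under eq_bigr do rewrite E mulr_sumr.
rewrite exchange_big /= [in RHS](mpolyE p) scaler_sumr.
rewrite [LHS]big_seq [RHS]big_seq; apply: eq_bigr => m /hp <-.
under eq_bigr do rewrite -(scalerAr _ (mpolyX R _)) xd scalerA mulrC -scalerA.
rewrite -scaler_suml -natr_sum.
by rewrite /= mdegE.
Qed.

Definition linform a : mpolyR := \sum_i a 0 i *: x_ i.

Lemma mderiv_linform i a : mderiv i (linform a) = mpolyC n (a 0 i).
Proof.
rewrite /linform (linear_sum (mderiv i)) (bigD1 i) //= big1 => [|j ji].
  by rewrite mderivZ mderivXU eqxx addr0 -[LHS]mul_mpolyC mulr1.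
by rewrite mderivZ mderivXU eq_sym (negPf ji) scaler0.
Qed.

Lemma dhomog_linform a : linform a \is ishomog1 1 mdeg.
Proof. by apply: rpred_sum => i _; apply: rpredZ; exact: dhomogXU. Qed.

Definition normsq : mpolyR := \sum_i x_ i * x_ i.

Lemma mderiv_normsq i : mderiv i normsq = 2 *: x_ i.
Proof.
rewrite /normsq (linear_sum (mderiv i)) (bigD1 i) //= big1 => [|j ji].
  by rewrite mderivM mderivXU eqxx mulr1 mul1r addr0 scaler_nat mulr2n.
by rewrite mderivM mderivXU eq_sym (negPf ji) mulr0 mul0r addr0.
Qed.

Lemma dhomog_normsq : normsq \is ishomog1 2 mdeg.
Proof.
by apply: rpred_sum => i _; apply: (@dhomogM _ _ mdeg 1 _ 1); exact: dhomogXU.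
Qed.

Definition lapl p : mpolyR := \sum_i mderiv i (mderiv i p).

Lemma laplM p q : lapl (p * q) =
  lapl p * q + 2 *: (\sum_i mderiv i p * mderiv i q) + p * lapl q.
Proof.
rewrite /lapl scaler_sumr mulr_suml mulr_sumr -!big_split; apply: eq_bigr => i _ /=.
by rewrite mderivM mderivD !mderivM scaler_nat mulr2n; ring.
Qed.

Lemma laplB p q : lapl (p - q) = lapl p - lapl q.
Proof.
by rewrite /lapl -sumrB; apply: eq_bigr => i _; rewrite !mderivB.
Qed.

Lemma laplZ c p : lapl (c *: p) = c *: lapl p.
Proof. by rewrite /lapl scaler_sumr; apply: eq_bigr => i _; rewrite !mderivZ. Qed.

Lemma lapl_mderiv i p : lapl p = 0 -> lapl (mderiv i p) = 0.
Proof.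
move=> h; transitivity (mderiv i (lapl p)); last by rewrite h mderiv0.
rewrite /lapl (linear_sum (mderiv i)); apply: eq_bigr => j _ /=.
by rewrite (mderiv_comm i j p) (mderiv_comm i j).
Qed.

Definition dirderiv a p : mpolyR := \sum_i a 0 i *: mderiv i p.

Lemma dirderivM a p q : dirderiv a (p * q) = dirderiv a p * q + p * dirderiv a q.
Proof.
rewrite /dirderiv mulr_suml mulr_sumr -big_split; apply: eq_bigr => i _ /=.
by rewrite mderivM scalerDr -scalerAl -scalerAr.
Qed.

Lemma dirderivB a p q : dirderiv a (p - q) = dirderiv a p - dirderiv a q.
Proof.
by rewrite /dirderiv -sumrB; apply: eq_bigr => i _; rewrite mderivB scalerBr.
Qed.

Lemma dirderiv_linform a : dotv a a = 1 -> dirderiv a (2 *: linform a) = 2.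
Proof.
move=> a1; rewrite /dirderiv.
under eq_bigr => i _.
  rewrite mderivZ mderiv_linform scalerA mulrC -scalerA -(mul_mpolyC (a 0 i)) -mpolyCM.
  over.
rewrite -scaler_sumr.
have -> : \sum_i mpolyC n (a 0 i * a 0 i) = mpolyC n (dotv a a) by rewrite raddf_sum.
by rewrite a1 mpolyC1 scaler_nat.
Qed.

Lemma dirderiv_normsq a : dirderiv a normsq = 2 *: linform a.
Proof.
rewrite /dirderiv /linform scaler_sumr; apply: eq_bigr => i _.
by rewrite mderiv_normsq !scalerA mulrC.
Qed.

End PolynomialCalculus.

Section Evaluation.
Variables (R : realType) (n : nat).
Local Notation mpolyR := (mpoly n R).
Local Notation x_ i := (mpolyX R (mnm1 i)).
Local Notation homog k := (ishomog1 k mdeg).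
Implicit Types (p q : mpolyR) (m : multinom n) (i : 'I_n) (a x : 'rV[R]_n).

Lemma peval_sum (I : Type) (r : seq I) (F : I -> mpolyR) x :
  peval (\sum_(i <- r) F i) x = \sum_(i <- r) peval (F i) x.
Proof. by rewrite /peval raddf_sum. Qed.

Lemma peval_linform a x : peval (linform a) x = dotv x a.
Proof.
rewrite peval_sum; apply: eq_bigr => i _.
by rewrite /peval mevalZ mevalXU mulrC.
Qed.

Lemma peval_normsq x : peval (normsq R n) x = dotv x x.
Proof.
rewrite /normsq peval_sum; apply: eq_bigr => i _.
by rewrite /peval mevalM mevalXU.
Qed.

Lemma euler_peval k H a : H \is homog k ->
  \sum_i a 0 i * peval (mderiv i H) a = k%:R * peval H a.
Proof.
move=> hH; rewrite /peval -mevalZ -(euler hH) raddf_sum; apply: eq_bigr => i _ /=.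
by rewrite mevalM mevalXU.
Qed.

Lemma is_derive_coord (u v : 'rV[R]_n) i :
  is_derive u v (fun w : 'rV[R]_n => w 0 i) (v 0 i).
Proof.
have d := @derivable_id _ _ u v.
have [/(_ d) dc _] := derivable_mxP (id : 'rV[R]_n -> 'rV[R]_n) u v.
apply: DeriveDef; first exact: dc.
by have := derive_mx d; rewrite derive_id => /(congr1 (fun M : 'rV[R]_n => M 0 i)); rewrite mxE.
Qed.

Lemma peval_derive p i x : is_derive x (delta_mx 0 i) (peval p) (peval (mderiv i p) x).
Proof.
elim/mpoly_ring_ind: p => [c|j|p q IHp IHq|p q IHp IHq].
- have -> : peval (mpolyC n c) = cst c by apply/funext => z; rewrite /peval mevalC.
  by rewrite /peval mderivC meval0; exact: is_derive_cst.
- have -> : peval (x_ j) = (fun z => z 0 j) by apply/funext => z; rewrite /peval mevalXU.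
  have := is_derive_coord x (delta_mx 0 i) j; rewrite mxE eqxx /= mderivXU eq_sym.
  by rewrite /peval rmorph_nat.
- have -> : peval (p + q) = peval p + peval q by apply/funext => z; rewrite /peval mevalD.
  have -> : peval (mderiv i (p + q)) x = peval (mderiv i p) x + peval (mderiv i q) x.
    by rewrite mderivD /peval mevalD.
  exact: is_deriveD.
- have -> : peval (p * q) = peval p * peval q by apply/funext => z; rewrite /peval mevalM.
  apply: is_derive_eq; rewrite mderivM /peval mevalD !mevalM /GRing.scale /=.
  by rewrite addrC mulrC; congr (_ + _); rewrite mulrC.
Qed.

Lemma peval_continuous p : continuous (peval p).
Proof.
elim/mpoly_ring_ind: p => [c|j|p q IHp IHq|p q IHp IHq] x.
- have -> : peval (mpolyC n c) = cst c by apply/funext => z; rewrite /peval mevalC.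
  exact: cst_continuous.
- have -> : peval (x_ j) = (fun z => z 0 j) by apply/funext => z; rewrite /peval mevalXU.
  exact: coord_continuous.
- have -> : peval (p + q) = peval p + peval q by apply/funext => z; rewrite /peval mevalD.
  exact: continuousD (IHp x) (IHq x).
- have -> : peval (p * q) = peval p * peval q by apply/funext => z; rewrite /peval mevalM.
  exact: continuousM (IHp x) (IHq x).
Qed.

Lemma peval_mderiv p i x : peval (mderiv i p) x = 'D_(delta_mx 0 i) (peval p) x.
Proof. by have [_ ->] := peval_derive p i x. Qed.

(** The partial derivatives also vanish everywhere, hence are zero by induction
on the degree, and Euler's identity gives p = 0. *)
Lemma peval_homog_eq0 k p : p \is homog k -> (forall x, peval p x = 0) -> p = 0.
Proof.
elim: k p => [|k IH] p hp p0.
  have := p0 0; rewrite (dhomog0_const hp) /peval mevalC => ->.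
  by rewrite mpolyC0.
have d0 i : mderiv i p = 0.
  apply: IH; first exact: dhomog_mderiv.
  move=> x; rewrite peval_mderiv (_ : peval p = cst 0) ?derive_cst //.
  by apply/funext => z; rewrite p0.
have := euler hp; rewrite big1 => [/esym/eqP|i _]; last by rewrite d0 mulr0.
by rewrite scaler_eq0 pnatr_eq0 /= => /eqP.
Qed.

Lemma peval_scale k p c x : p \is homog k -> peval p (c *: x) = c ^+ k * peval p x.
Proof.
move=> /dhomogP hp; rewrite [p]mpolyE !peval_sum mulr_sumr.
rewrite [LHS]big_seq [RHS]big_seq; apply: eq_bigr => m /hp mk.
rewrite /peval !mevalZ mulrCA; congr (_ * _); rewrite !mevalX.
rewrite -mk /= mdegE expr_sum -big_split; apply: eq_bigr => i _ /=.
by rewrite mxE exprMn.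
Qed.

Lemma peval_sphere_eq0 k p a : p \is homog k -> dotv a a = 1 ->
  (forall b, dotv b b = 1 -> peval p b = 0) -> p = 0.
Proof.
move=> hp a1 p0; apply: (peval_homog_eq0 hp) => x.
have [->|x0] := eqVneq x 0.
  (* the origin is a multiple of a, even if p is a constant *)
  by rewrite -[0](scale0r a) (peval_scale _ _ hp) p0 ?mulr0.
have n0 : enorm x != 0 by rewrite -sqrf_eq0 enorm_dotv dotv_eq0.
have -> : x = enorm x *: ((enorm x)^-1 *: x) by rewrite scalerA divff ?scale1r.
rewrite (peval_scale _ _ hp) p0 ?mulr0 //.
by rewrite dotvZ -enorm_dotv -exprMn mulVf ?expr1n.
Qed.

End Evaluation.

(** * Harmonic functions with a pole at the origin *)

Section Smoothness.
Variables (R : realType) (d : nat) (V : normedModType R).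
Implicit Types (U : set 'rV[R]_d) (f g : 'rV[R]_d -> V).

Lemma is_derive_scaler (r : 'rV[R]_d -> R) (w : V) x v dr :
  is_derive x v r dr -> is_derive x v (fun z => r z *: w) (dr *: w).
Proof.
move=> [dx <-].
have h : (fun h => h^-1 *: (((fun z => r z *: w) \o shift x) (h *: v) - r x *: w)) @ 0^' -->
    'D_v r x *: w.
  have := cvgZr_tmp (a := w) dx.
  under eq_fun => h do rewrite -scalerA scalerBl.
  exact.
apply: DeriveDef; first by apply/cvg_ex; exists ('D_v r x *: w).
exact: cvg_lim.
Qed.

Lemma near_open_eq U f g x : open U -> U x -> {in U, f =1 g} -> \near x, f x = g x.
Proof.
move=> oU Ux fg; have : nbhs x U by exact: open_nbhs_nbhs.
by apply: filterS => z Uz; apply: fg; exact/mem_set.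
Qed.

(** Limits and derivatives at the points of an open set depend only on the
values on that set; the functions below have no useful value at 0. *)
Lemma Ck_on_congr k U f g : open U -> {in U, f =1 g} -> Ck_on k U g -> Ck_on k U f.
Proof.
move=> oU; elim: k f g => [|k IH] f g fg [gc gd]; split.
- move=> x Ux; have nfg := near_open_eq oU Ux fg.
  rewrite /prop_for /continuous_at fg; last exact/mem_set.
  apply: cvg_trans (gc x Ux); apply: (near_eq_cvg (F := nbhs x)).
  by apply: filterS nfg => z ->.
- by [].
- move=> x Ux; have nfg := near_open_eq oU Ux fg.
  rewrite /prop_for /continuous_at fg; last exact/mem_set.
  apply: cvg_trans (gc x Ux); apply: (near_eq_cvg (F := nbhs x)).
  by apply: filterS nfg => z ->.
- move=> i; have [gd1 gd2] := gd i; split.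
    move=> x Ux; apply: (near_eq_derivable (f := g)); last exact: gd1.
    by apply: near_open_eq Ux _ => // z Uz; rewrite fg.
  apply: IH gd2 => x /set_mem Ux; rewrite /partial.
  by apply: near_eq_derive; exact: near_open_eq Ux fg.
Qed.

Lemma harmonic_on_congr U f g :
  open U -> {in U, f =1 g} -> harmonic_on U g -> harmonic_on U f.
Proof.
move=> oU fg [gC gL]; split; first exact: Ck_on_congr gC.
move=> x Ux; rewrite -(gL x Ux); apply: eq_bigr => i _.
apply: near_eq_derive; apply: near_open_eq Ux _ => // z /set_mem Uz.
by apply: near_eq_derive; exact: near_open_eq Uz fg.
Qed.

End Smoothness.

Section Rational.
Variables (R : realType) (n : nat) (V : normedModType R) (w : V).
Local Notation mpolyR := (mpoly n R).
Local Notation x_ i := (mpolyX R (mnm1 i)).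
Local Notation N := (normsq R n).
Implicit Types (p q : mpolyR) (i : 'I_n) (x : 'rV[R]_n) (j k : nat).

Definition punctured : set 'rV[R]_n := [set x | x != 0].

Lemma open_punctured : open punctured.
Proof.
have -> : punctured = ~` [set 0 : 'rV[R]_n].
  by apply/seteqP; split => x /=; [move/eqP | move=> h; apply/eqP].
by apply: closed_openC; exact/accessible_closed_set1/hausdorff_accessible/norm_hausdorff.
Qed.

(** The functions p / |x|^(2 j), which are closed under differentiation. *)
Definition rational p j x : V := (peval p x / peval N x ^+ j) *: w.

(** The numerator of the derivative over |x|^(2 (j + 1)). *)
Definition rational_partial p j i : mpolyR := N * mderiv i p - (2 * j%:R) * x_ i * p.

Lemma rational_derive p j i x : x != 0 ->
  is_derive x (delta_mx 0 i) (rational p j) (rational (rational_partial p j i) j.+1 x).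
Proof.
rewrite -dotv_eq0 -peval_normsq => N0; apply: is_derive_scaler.
have dN := peval_derive N i x; rewrite mderiv_normsq in dN.
have dV : is_derive x (delta_mx 0 i) (fun z => (peval N z)^-1)
    (- peval N x ^- 2 * (2 * x 0 i)).
  have [d1 d2] := dN; apply: DeriveDef; first exact: derivableV.
  rewrite deriveV // d2 /GRing.scale /= /peval mevalZ mevalXU; ring.
have -> : (fun z => peval p z / peval N z ^+ j) = peval p * (fun z => (peval N z)^-1) ^+ j.
  by apply/funext => z; rewrite !fctE exprVn.
have dp := peval_derive p i x.
have e : peval (rational_partial p j i) x =
    peval N x * peval (mderiv i p) x - 2 * j%:R * x 0 i * peval p x.
  by rewrite /peval /rational_partial mevalB !mevalM mevalXU !rmorph_nat.
apply: is_derive_eq; rewrite !fctE e /GRing.scale /=.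
move: (peval N x) (peval p x) (peval (mderiv i p) x) (x 0 i) N0 => c p0 p1 xi c0.
case: j {e} => [|j] /=; first by rewrite expr1 !expr0; field.
rewrite !exprS !exprVn; have : c ^+ j != 0 by rewrite expf_neq0.
move: (c ^+ j) => u u0; by field; rewrite c0 u0.
Qed.

Lemma rational_continuous p j x : x != 0 -> {for x, continuous (rational p j)}.
Proof.
rewrite -dotv_eq0 -peval_normsq => N0.
have cN : (fun z => peval N z ^+ j) @ nbhs x --> peval N x ^+ j.
  exact: (cvg_comp _ _ (@peval_continuous R n N x) (@exprn_continuous R j _)).
apply: (cvgZr_tmp (F := nbhs x)); apply: (cvgM (F := nbhs x)).
  exact: peval_continuous.
by apply: (cvgV (F := nbhs x)) => //; rewrite expf_neq0.
Qed.

Lemma rational_Ck k p j : Ck_on k punctured (rational p j).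
Proof.
elim: k p j => [|k IH] p j; split => //; try by move=> x; exact: rational_continuous.
move=> i; split; first by move=> x x0; have [] := rational_derive p j i x0.
apply: (@Ck_on_congr _ _ _ _ _ _ (rational (rational_partial p j i) j.+1)) => //.
  exact: open_punctured.
by move=> x /set_mem x0; have [_] := rational_derive p j i x0.
Qed.

Lemma rational_laplacian p j x : x != 0 ->
  laplacian (rational p j) x =
  rational (\sum_i rational_partial (rational_partial p j i) j.+1 i) j.+2 x.
Proof.
move=> x0; rewrite /laplacian /rational peval_sum mulr_suml scaler_suml.
apply: eq_bigr => i _; rewrite -/(rational _ _ x).
have [_ <-] := rational_derive (rational_partial p j i) j.+1 i x0.
apply: near_eq_derive; apply: near_open_eq open_punctured x0 _ => z /set_mem z0.
by have [_] := rational_derive p j i z0.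
Qed.

End Rational.

Section RationalHarmonic.
Variables (R : realType) (V : normedModType R) (w : V).
Local Notation poly4 := (mpoly 4 R).
Local Notation x_ i := (mpolyX R (mnm1 i)).
Local Notation N := (normsq R 4).
Implicit Types (p : poly4) (k : nat).

(** With j = k + 1 the sum equals
|x|^4 lap p - 4 j |x|^2 E p + 4 j (j + 1 - 2) |x|^2 p, where E is the Euler
operator: the term 4 j (j + 1) comes from the gradient of |x|^2, and - 8 j from
its Laplacian in dimension 4. Since E p = k p, this vanishes. *)
Lemma kelvin_numerator k p : p \is ishomog1 k mdeg -> lapl p = 0 ->
  \sum_i rational_partial (rational_partial p k.+1 i) k.+2 i = 0.
Proof.
move=> hp p0; set j : poly4 := k.+1%:R.
transitivity (\sum_i (N ^+ 2 * mderiv i (mderiv i p) - 4 * j * N * (x_ i * mderiv i p)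
   - 2 * j * N * p + 4 * j * (j + 1) * p * (x_ i * x_ i))).
  apply: eq_bigr => i _; rewrite /rational_partial -/j.
  have dn (n : nat) : mderiv i (n%:R : poly4) = 0 by rewrite -mpolyC_nat mderivC.
  rewrite mderivB !mderivM /j !dn mderivXU eqxx mderiv_normsq -[k.+2%:R]natr1 -/j.
  rewrite -mulr_algl scaler_nat mulr1; ring.
rewrite !big_split /= sumrN -!mulr_sumr -/(lapl p) p0 (euler hp) -/(normsq R 4).
rewrite sumrN big_const_ord iter_addr_0 -mulr_algl scaler_nat /j -natr1; ring.
Qed.

Lemma rational_harmonic k p : p \is ishomog1 k mdeg -> lapl p = 0 ->
  harmonic_on (@punctured R 4) (rational w p k.+1).
Proof.
move=> hp p0; split; first exact: rational_Ck.
by move=> x x0; rewrite rational_laplacian // kelvin_numerator // /rational /peval meval0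
  mul0r scale0r.
Qed.

End RationalHarmonic.

(** * Integration over the sphere *)

Section ProductIntegral.
Context d1 d2 (T1 : measurableType d1) (T2 : measurableType d2) (R : realType).
Variable m1 : {sigma_finite_measure set T1 -> \bar R}.
Variable m2 : {sigma_finite_measure set T2 -> \bar R}.
Variables (A : set T1) (B : set T2) (f : T1 -> R) (g : T2 -> R).
Hypotheses (mA : measurable A) (mB : measurable B).
Hypotheses (fA : m1.-integrable A (EFin \o f)) (gB : m2.-integrable B (EFin \o g)).

Let F := f \_ A.
Let G := g \_ B.

Let iF : m1.-integrable setT (EFin \o F).
Proof. by rewrite -restrict_EFin; apply/(integrable_mkcond _ mA). Qed.

Let iG : m2.-integrable setT (EFin \o G).
Proof. by rewrite -restrict_EFin; apply/(integrable_mkcond _ mB). Qed.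

Let mF : measurable_fun setT F.
Proof. by apply/measurable_EFinP; exact: measurable_int iF. Qed.

Let mG : measurable_fun setT G.
Proof. by apply/measurable_EFinP; exact: measurable_int iG. Qed.

Let FG (t : T1 * T2) : (F t.1 * G t.2) = ((fun t => f t.1 * g t.2) \_ (A `*` B)) t.
Proof.
rewrite /F /G !patchE in_setX; case: (t.1 \in A); case: (t.2 \in B) => //=;
by rewrite ?mul0r ?mulr0.
Qed.

Let iFG : (m1 \x m2)%E.-integrable setT (fun t => (F t.1 * G t.2)%:E).
Proof.
apply/integrable12ltyP.
  apply/measurable_EFinP; apply: measurable_funM.
    by apply: measurableT_comp => //; exact: measurable_fst.
  by apply: measurableT_comp => //; exact: measurable_snd.
under eq_integral => x _.
  under eq_integral => y _ do rewrite /= normrM EFinM.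
  rewrite ge0_integralZl //; last first.
    by apply/measurable_EFinP; exact: measurableT_comp.
  over.
rewrite ge0_integralZr //; last 2 first.
- by apply/measurable_EFinP; exact: measurableT_comp.
- exact: integral_ge0.
have /integrableP[_ hF] := iF.
have /integrableP[_ hG] := iG.
by apply: lte_mul_pinfty; rewrite ?integral_ge0 // ge0_fin_numE // integral_ge0.
Qed.

Lemma integrable_prod :
  (m1 \x m2)%E.-integrable (A `*` B) (fun t => (f t.1 * g t.2)%:E).
Proof.
apply/(integrable_mkcond _ (measurableX mA mB)).
rewrite (_ : _ \_ _ = (fun t => (F t.1 * G t.2)%:E)) //.
apply/funext => t; rewrite FG !patchE; case: ifP => //.
Qed.

Lemma Rintegral_prod :
  Rintegral (m1 \x m2)%E (A `*` B) (fun t => f t.1 * g t.2) =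
  Rintegral m1 A f * Rintegral m2 B g.
Proof.
rewrite (Rintegral_mkcond _ (A `*` B)) (Rintegral_mkcond _ A) (Rintegral_mkcond _ B).
rewrite -/F -/G; under eq_Rintegral do rewrite -FG.
rewrite /Rintegral -integral12_prod_meas1 // /fubini_F /=.
under eq_integral => x _.
  under eq_integral => y _ do rewrite EFinM.
  rewrite (integralZl measurableT iG (F x)).
  over.
have /integrable_fin_num fG := iG.
rewrite -(fineK (fG measurableT)).
by rewrite integralZr //= fineM //; exact: integrable_fin_num.
Qed.

End ProductIntegral.

Section TrigonometricMoments.
Variable R : realType.
Implicit Types (a b : nat) (c : R).
Local Notation mu := (@lebesgue_measure R).

(** With Cartesian coordinates expressed in spherical ones, monomials become
products of these functions of one angle each. *)
Definition cossin a b (t : R) : R := cos t ^+ a * sin t ^+ b.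

Definition trig_moment c a b : R := Rintegral mu `[0, c] (cossin a b).

Lemma cossin_continuous a b : continuous (cossin a b).
Proof.
move=> t; apply: cvgM.
  exact: (cvg_comp _ _ (@continuous_cos R t) (@exprn_continuous R a (cos t))).
exact: (cvg_comp _ _ (@continuous_sin R t) (@exprn_continuous R b (sin t))).
Qed.

Lemma cossin_integrable c a b : mu.-integrable `[0, c] (EFin \o cossin a b).
Proof.
apply: continuous_compact_integrable; first exact: segment_compact.
by apply: continuous_subspaceT; exact: cossin_continuous.
Qed.

Lemma cossin_derive a b (t : R) :
  is_derive t 1 (cossin a b)
    (b%:R * cossin a.+1 b.-1 t - a%:R * cossin a.-1 b.+1 t).
Proof.
have -> : cossin a b = (@cos R ^+ a) * (@sin R ^+ b).
  by apply/funext => u; rewrite /cossin /= !fctE.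
apply: is_derive_eq.
rewrite /cossin !exprS !scalerAl /= /GRing.scale /= !fctE; ring.
Qed.

Lemma trig_moment_derive c a b : 0 < c ->
  b%:R * trig_moment c a.+1 b.-1 - a%:R * trig_moment c a.-1 b.+1
  = cossin a b c - cossin a b 0.
Proof.
move=> c0; rewrite /trig_moment -!RintegralZl //; try exact: cossin_integrable.
have iZ k a' b' : mu.-integrable `[0, c] (EFin \o (fun x => k * cossin a' b' x)).
  by have := integrableZl _ k (cossin_integrable c a' b'); apply.
rewrite -RintegralB //; try exact: iZ.
rewrite /Rintegral (@continuous_FTC2 _ _ (cossin a b)) // .
- apply: continuous_subspaceT => t.
  by apply: cvgB; apply: cvgMl_tmp; exact: cossin_continuous.
- split; first by move=> t _; have [] := cossin_derive a b t.
    by apply: cvg_at_right_filter; exact: cossin_continuous.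
  by apply: cvg_at_left_filter; exact: cossin_continuous.
- by move=> t _; rewrite derive1E; have [] := cossin_derive a b t.
Qed.

Lemma trig_moment_pythagoras c a b :
  trig_moment c a.+2 b + trig_moment c a b.+2 = trig_moment c a b.
Proof.
rewrite -RintegralD //; try exact: cossin_integrable.
apply: eq_Rintegral => t _; rewrite /cossin.
by rewrite -[RHS]mul1r -(cos2Dsin2 t) !exprS; ring.
Qed.

(** The derivative of cos^a sin^(b+1) has integral 0, the sine being 0 at both
ends; then sin^2 is replaced with 1 - cos^2. *)
Lemma trig_moment_cosS c a b : 0 < c -> sin c = 0 ->
  (a + b).+1%:R * trig_moment c a.+1 b = a%:R * trig_moment c a.-1 b.
Proof.
move=> c0 sc; have := trig_moment_derive a b.+1 c0.
rewrite /cossin sc sin0 !expr0n /= !mulr0 subrr => /eqP.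
rewrite subr_eq0 => /eqP h; case: a h => [|a] h.
  by rewrite !mul0r in h *; rewrite -h.
have := trig_moment_pythagoras c a b; rewrite /= in h *.
by move=> <-; rewrite mulrDr -h -natr1 -addn1 !natrD; ring.
Qed.

(** The same with cos^(a+1) sin^b. For b = 0 there is no sine to annihilate the
boundary terms, and they cancel only if c is a period of cos. *)
Lemma trig_moment_sinS c a b : 0 < c -> sin c = 0 -> (0 < b)%N || (cos c == 1) ->
  (a + b).+1%:R * trig_moment c a b.+1 = b%:R * trig_moment c a b.-1.
Proof.
move=> c0 sc bc; have := trig_moment_derive a.+1 b c0.
have -> : cossin a.+1 b c - cossin a.+1 b 0 = 0.
  rewrite /cossin sc sin0 cos0; case: b bc => [/eqP ->|b _].
    by rewrite !expr1n subrr.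
  by rewrite !expr0n /= !mulr0 subrr.
move=> /eqP; rewrite subr_eq0 => /eqP h; case: b h {bc} => [|b] h.
  by rewrite !mul0r in h *; rewrite addn0.
have := trig_moment_pythagoras c a b; rewrite /= in h *.
by move=> <-; rewrite mulrDr h -natr1 natrD -!natr1; ring.
Qed.

End TrigonometricMoments.

Section SphericalCoordinates.
Variable R : realType.

Lemma is_derive_comp_real (V : normedModType R) (phi : R -> R) (g : V -> R)
    (x v : V) dphi dg :
  is_derive (g x) 1 phi dphi -> differentiable g x -> is_derive x v g dg ->
  is_derive x v (phi \o g) (dphi * dg).
Proof.
move=> [p1 p2] gx [_ g2].
have px : differentiable phi (g x) by exact/derivable1_diffP.
have cx : differentiable (phi \o g) x by exact: differentiable_comp.
apply: DeriveDef; first exact: diff_derivable.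
rewrite deriveE // diff_comp //= deriv1E // -(deriveE v gx) g2 derive1E p2.
by rewrite /GRing.scale /= mulrC.
Qed.

Lemma is_derive_cos_coord n (u : 'rV[R]_n) i j :
  is_derive u (delta_mx 0 j) (fun w : 'rV[R]_n => cos (w 0 i))
    (- sin (u 0 i) * (i == j)%:R).
Proof.
have := is_derive_coord u (delta_mx 0 j) i; rewrite mxE eqxx /= => d.
by apply: (is_derive_comp_real _ _ d); exact: differentiable_coord.
Qed.

Lemma is_derive_sin_coord n (u : 'rV[R]_n) i j :
  is_derive u (delta_mx 0 j) (fun w : 'rV[R]_n => sin (w 0 i))
    (cos (u 0 i) * (i == j)%:R).
Proof.
have := is_derive_coord u (delta_mx 0 j) i; rewrite mxE eqxx /= => d.
by apply: (is_derive_comp_real _ _ d); exact: differentiable_coord.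
Qed.

Definition spherical_jacobian (u : 'rV[R]_3) : 'M[R]_(3, 4) :=
  let c i := cos (u 0 i) in let s i := sin (u 0 i) in
  \matrix_(j < 3, k < 4)
   nth 0 (nth [::] [::
    [:: - s 0; c 0 * c 1; c 0 * s 1 * c 2; c 0 * s 1 * s 2];
    [:: 0; - s 0 * s 1; s 0 * c 1 * c 2; s 0 * c 1 * s 2];
    [:: 0; 0; - s 0 * s 1 * s 2; s 0 * s 1 * c 2]] j) k.

Lemma spherical_jacobianE u :
  \matrix_(j < 3, k < 4) partial j (fun v => spherical v 0 k) u =
  spherical_jacobian u.
Proof.
apply/matrixP => j k; rewrite !mxE /partial.
have C i : is_derive u (delta_mx 0 j) (fun w : 'rV[R]_3 => cos (w 0 i)) _ :=
  is_derive_cos_coord u i j.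
have S i : is_derive u (delta_mx 0 j) (fun w : 'rV[R]_3 => sin (w 0 i)) _ :=
  is_derive_sin_coord u i j.
case: k => [[|[|[|[|k]]]] //= kP].
- have -> : (fun v : 'rV[R]_3 => spherical v 0 (Ordinal kP)) = fun v => cos (v 0 0).
    by apply/funext => v; rewrite mxE.
  have [_ ->] := C 0; case: j {C S} => [[|[|[|j]]] //= jP]; rewrite ?mulr0 ?mulr1 //.
- have -> : (fun v : 'rV[R]_3 => spherical v 0 (Ordinal kP)) =
    (fun v => sin (v 0 0)) * (fun v => cos (v 0 1)).
    by apply/funext => v; rewrite mxE.
  have [_ ->] := is_deriveM (S 0) (C 1).
  case: j {C S} => [[|[|[|j]]] //= jP]; rewrite /GRing.scale /=; ring.
- have -> : (fun v : 'rV[R]_3 => spherical v 0 (Ordinal kP)) =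
    (fun v => sin (v 0 0)) * (fun v => sin (v 0 1)) * (fun v => cos (v 0 2)).
    by apply/funext => v; rewrite mxE.
  have [_ ->] := is_deriveM (is_deriveM (S 0) (S 1)) (C 2).
  case: j {C S} => [[|[|[|j]]] //= jP]; rewrite /GRing.scale /= !fctE; ring.
- have -> : (fun v : 'rV[R]_3 => spherical v 0 (Ordinal kP)) =
    (fun v => sin (v 0 0)) * (fun v => sin (v 0 1)) * (fun v => sin (v 0 2)).
    by apply/funext => v; rewrite mxE.
  have [_ ->] := is_deriveM (is_deriveM (S 0) (S 1)) (S 2).
  case: j {C S} => [[|[|[|j]]] //= jP]; rewrite /GRing.scale /= !fctE; ring.
Qed.

(** Spherical coordinates are orthogonal. *)
Lemma spherical_gram u :
  spherical_jacobian u *m (spherical_jacobian u)^T =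
  diag_mx (\row_(j < 3) nth 0 [:: 1; sin (u 0 0) ^+ 2;
                                 (sin (u 0 0) * sin (u 0 1)) ^+ 2] j).
Proof.
have C i : cos (u 0 i) ^+ 2 = 1 - sin (u 0 i) ^+ 2.
  by rewrite -(cos2Dsin2 (u 0 i)) addrK.
apply/matrixP => i j; rewrite !mxE !big_ord_recl big_ord0 !mxE /=.
case: i => [[|[|[|i]]] //= iP]; case: j => [[|[|[|j]]] //= jP];
  rewrite ?mulr0n ?mulr1n; ring: (C 0) (C 1) (C 2).
Qed.

Lemma area_densityE (u : 'rV[R]_3) : 0 <= u 0 1 <= pi ->
  area_density u = sin (u 0 0) ^+ 2 * sin (u 0 1).
Proof.
move=> u1; rewrite /area_density spherical_jacobianE spherical_gram det_diag.
rewrite !big_ord_recl big_ord0 !mxE /=.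
have -> : 1 * (sin (u 0 0) ^+ 2 * ((sin (u 0 0) * sin (u 0 1)) ^+ 2 * 1)) =
  (sin (u 0 0) ^+ 2 * sin (u 0 1)) ^+ 2 by ring.
by rewrite sqrtr_sqr ger0_norm // mulr_ge0 ?sqr_ge0 // sin_ge0_pi.
Qed.

Lemma spherical_unit u : dotv (@spherical R u) (spherical u) = 1.
Proof.
have C i : cos (u 0 i) ^+ 2 = 1 - sin (u 0 i) ^+ 2.
  by rewrite -(cos2Dsin2 (u 0 i)) addrK.
rewrite /dotv !big_ord_recl big_ord0 !mxE /=.
ring: (C 0) (C 1) (C 2).
Qed.

End SphericalCoordinates.

(** The plane measure under a name of its own, which carries the
sigma-finiteness required of a factor in Fubini's theorem. *)
Definition lebesgue2 (R : realType) :=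
  (@lebesgue_measure R \x @lebesgue_measure R)%E.

Section Lebesgue2.
Variable R : realType.
Local Notation mu := (@lebesgue_measure R).

HB.instance Definition _ := measure_function.Measure.copy (@lebesgue2 R) (mu \x mu)%E.

Lemma lebesgue2_sigma_finite : sigma_finite setT (@lebesgue2 R).
Proof.
have /sigma_finiteP[F [FT ndF Foo]] := sigma_finiteT mu.
exists (fun n => F n `*` F n).
  apply/esym/seteqP; split => // -[x y] _.
  have [[i _ Fx] [j _ Fy]] : (\bigcup_n F n) x /\ (\bigcup_n F n) y by rewrite -FT.
  exists (maxn i j) => //; split => /=.
    by have /subsetPset := ndF _ _ (leq_maxl i j); apply.
  by have /subsetPset := ndF _ _ (leq_maxr i j); apply.
move=> n; have [mF Fn] := Foo n; split; first exact: measurableX.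
rewrite /lebesgue2 product_measure1E //.
by rewrite lte_mul_pinfty // ge0_fin_numE.
Qed.

HB.instance Definition _ := Measure_isSigmaFinite.Build _ _ _ (@lebesgue2 R)
  lebesgue2_sigma_finite.

End Lebesgue2.

Section SphereMoments.
Variable R : realType.
Local Notation mu := (@lebesgue_measure R).
Local Notation poly4 := (mpoly 4 R).
Implicit Types (p q : poly4) (m : multinom 4) (i : 'I_4).

(** The indices as numerals, in place of iterated lifts. *)
Definition ord4 k : 'I_4 := inord k.

Lemma big_ord4 (T : Type) (idx : T) (op : Monoid.law idx) (F : 'I_4 -> T) :
  \big[op/idx]_i F i = op (op (op (F (ord4 0)) (F (ord4 1))) (F (ord4 2))) (F (ord4 3)).
Proof.
rewrite !big_ord_recl big_ord0 Monoid.mulm1 !Monoid.mulmA.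
by congr (op (op (op (F _) (F _)) (F _)) (F _)); apply: val_inj; rewrite /= inordK.
Qed.

(** The successors come from the factor sin^2(psi) sin(theta) of the area
density. *)
Definition monomial_moment (a b c d : nat) : R :=
  trig_moment pi a (b + c + d).+2 * trig_moment pi b (c + d).+1
  * trig_moment (2 * pi) c d.

Definition angle_box : set (R * R * R) :=
  (`[0, pi] `*` `[0, pi]) `*` `[0, 2 * pi].

Definition angles (t : R * R * R) : 'rV[R]_3 := \row_(j < 3) [:: t.1.1; t.1.2; t.2]`_j.

Lemma monomial_density m t : t \in angle_box ->
  peval (mpolyX R m) (spherical (angles t)) * area_density (angles t) =
  cossin (m (ord4 0)) (m (ord4 1) + m (ord4 2) + m (ord4 3)).+2 t.1.1
  * cossin (m (ord4 1)) (m (ord4 2) + m (ord4 3)).+1 t.1.2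
  * cossin (m (ord4 2)) (m (ord4 3)) t.2.
Proof.
move=> /set_mem[[_ +] _]; rewrite /= in_itv /= => t2.
rewrite area_densityE; last by rewrite mxE.
rewrite /peval mevalX big_ord4 /= !mxE /= !inordK //= /cossin !exprMn !exprS !exprD.
ring.
Qed.

Lemma box_measurable : measurable
  (angle_box : set (measurableTypeR R * measurableTypeR R * measurableTypeR R)).
Proof. by apply: measurableX => //; exact: measurableX. Qed.

Lemma monomial_box m :
  ((mu \x mu) \x mu)%E.-integrable angle_box
     (fun t => (peval (mpolyX R m) (spherical (angles t)) * area_density (angles t))%:E) /\
  surface_integral (peval (mpolyX R m)) =
  monomial_moment (m (ord4 0)) (m (ord4 1)) (m (ord4 2)) (m (ord4 3)).
Proof.
set a := m (ord4 0); set b := m (ord4 1); set c := m (ord4 2); set d := m (ord4 3).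
pose f := cossin (R := R) a (b + c + d).+2; pose g := cossin (R := R) b (c + d).+1.
pose h := cossin (R := R) c d.
have If : mu.-integrable `[0, pi] (EFin \o f) by exact: cossin_integrable.
have Ig : mu.-integrable `[0, pi] (EFin \o g) by exact: cossin_integrable.
have Ih : mu.-integrable `[0, 2 * pi] (EFin \o h) by exact: cossin_integrable.
have mI (c' : R) : measurable (`[0, c'] : set R) by exact: measurable_itv.
have i1 := integrable_prod (m1 := mu) (m2 := mu) (mI pi) (mI pi) If Ig.
have mII : measurable (`[0, pi] `*` `[0, pi] : set (measurableTypeR R * measurableTypeR R)).
  exact: measurableX.
have i2 := integrable_prod (m1 := @lebesgue2 R) (m2 := mu) mII (mI (2 * pi)) i1 Ih.
split.
  apply: eq_integrable i2; first exact: box_measurable.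
  by move=> t tB; rewrite monomial_density.
rewrite /monomial_moment /trig_moment.
rewrite -(Rintegral_prod (m1 := mu) (m2 := mu) (mI pi) (mI pi) If Ig).
rewrite -(Rintegral_prod (m1 := @lebesgue2 R) (m2 := mu) mII (mI (2 * pi)) i1 Ih).
by apply: eq_Rintegral => t tB; exact: monomial_density.
Qed.

End SphereMoments.

Section SphereMean.
Variable R : realType.
Local Notation mu := (@lebesgue_measure R).
Local Notation poly4 := (mpoly 4 R).
Local Notation x_ i := (mpolyX R (mnm1 i)).
Implicit Types (p q : poly4) (m : multinom 4) (i : 'I_4) (c : R).

Lemma poly_box_integrable p :
  ((mu \x mu) \x mu)%E.-integrable (@angle_box R)
     (fun t => (peval p (spherical (angles t)) * area_density (angles t))%:E).
Proof.
elim/mpolyind: p => [|c m p _ _ IH].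
  apply: eq_integrable (integrable0 _ _); first exact: box_measurable.
  by move=> t _; rewrite /peval meval0 mul0r.
have [im _] := monomial_box R m.
have H := integrableD (@box_measurable R) (integrableZl (@box_measurable R) c im) IH.
apply: eq_integrable H; first exact: box_measurable.
by move=> t _ /=; rewrite /peval mevalD mevalZ mulrDl -mulrA EFinD EFinM.
Qed.

Lemma surface_integral_linear c p q :
  surface_integral (peval (c *: p + q)) =
  c * surface_integral (peval p) + surface_integral (peval q).
Proof.
have ip := poly_box_integrable p; have iq := poly_box_integrable q.
have icp := integrableZl (@box_measurable R) c ip.
rewrite /surface_integral.
rewrite -(RintegralZl c (@box_measurable R) ip).
rewrite -(RintegralD (@box_measurable R) icp iq).
apply: eq_Rintegral => t _; rewrite /peval mevalD mevalZ.
by rewrite mulrDl mulrA.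
Qed.

Definition mean p : R := sphere_mean (peval p).

Lemma mean_linear : scalar mean.
Proof.
move=> c p q; rewrite /mean /sphere_mean surface_integral_linear.
by rewrite mulrDl mulrA.
Qed.

HB.instance Definition _ :=
  GRing.isLinear.Build R poly4 R *%R mean mean_linear.

Lemma meanZ c p : mean (c *: p) = c * mean p.
Proof. by rewrite linearZ. Qed.

Lemma meanD p q : mean (p + q) = mean p + mean q.
Proof. exact: raddfD. Qed.

Lemma mean_sum (I : Type) (r : seq I) (F : I -> poly4) :
  mean (\sum_(i <- r) F i) = \sum_(i <- r) mean (F i).
Proof. exact: raddf_sum. Qed.

Lemma sphere_mean_peval p q :
  sphere_mean (fun z => peval p z * peval q z) = mean (p * q).
Proof.
by rewrite /mean; congr sphere_mean; apply/funext => z; rewrite /peval mevalM.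
Qed.

Lemma surface_integral1 : surface_integral (cst (1 : R)) != 0.
Proof.
have -> : surface_integral (cst (1 : R)) = monomial_moment R 0 0 0 0.
  have [_] := monomial_box R mnm0; rewrite !mnm0E => <-.
  congr surface_integral; apply/funext => x.
  by rewrite /peval mpolyX0 meval1.
have p0 : 0 < pi :> R by exact: pi_gt0.
have p20 : 0 < 2 * pi :> R by rewrite mulr_gt0.
have T0 c : 0 <= c -> trig_moment c 0 0 = c :> R.
  move=> c0; rewrite /trig_moment.
  transitivity (Rintegral mu `[0, c] (cst 1)).
    by apply: eq_Rintegral => t _; rewrite /cossin !expr0 mulr1.
  rewrite Rintegral_cst //= mul1r lebesgue_measure_itv /= lte_fin.
  by case: ltgtP c0 => //= _ _; rewrite subr0.
have T2 : 2 * trig_moment pi 0 2 = pi :> R.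
  have := @trig_moment_sinS R pi 0 1 p0 (sinpi R) isT.
  by rewrite T0 ?mul1r // ltW.
have T1 : trig_moment pi 0 1 = 2 :> R.
  have := @trig_moment_derive R pi 1 0 p0.
  rewrite /cossin cospi cos0 /= !expr0 !expr1 !mul0r sub0r !mulr1 mul1r.
  by move=> h; apply: oppr_inj; rewrite h; ring.
rewrite /monomial_moment !add0n T1 T0 ?ltW // !mulf_neq0 ?gt_eqF //.
by rewrite -(pmulr_rgt0 _ (ltr0Sn R 1)) T2.
Qed.

Lemma mean1 : mean 1 = 1.
Proof.
rewrite /mean /sphere_mean.
have -> : peval (1 : poly4) = cst 1 :> ('rV[R]_4 -> R) by apply/funext => x; rewrite /peval meval1.
by rewrite divff // surface_integral1.
Qed.

Lemma mean_normsq p : mean (normsq R 4 * p) = mean p.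
Proof.
rewrite /mean /sphere_mean; congr (_ / _); rewrite /surface_integral.
apply: eq_Rintegral => t _; congr (_ * _).
rewrite /peval mevalM; have := peval_normsq (spherical (angles t)).
by rewrite spherical_unit /peval => ->; rewrite mul1r.
Qed.

(** Multiplication by x_i adds a cosine to the factor of the i-th angle and a
sine to the factors of the preceding angles. The recurrences for the moments
are applied to these factors in turn, and their constants cancel. *)
Lemma mean_monomial_shift i m :
  (mdeg m + 3)%:R * mean (x_ i * mpolyX R m) = mean (mderiv i (mpolyX R m)).
Proof.
rewrite mderivX linearZ /= -mpolyXD /mean /sphere_mean !mulrA; congr (_ / _).
rewrite (monomial_box _ _).2 (monomial_box _ _).2.
rewrite !mnmDE !mnmBE !mnm1E mdegE big_ord4.
have p0 : 0 < pi :> R by exact: pi_gt0.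
have p20 : 0 < 2 * pi :> R by rewrite mulr_gt0.
have s2 : sin (2 * pi) = 0 :> R by rewrite mulr_natl sin2pi.
have c2 : cos (2 * pi) == 1 :> R by rewrite mulr_natl cos2pi.
have i4 : i = ord4 i by apply: val_inj; rewrite /= inordK.
have oE k l : (k < 4)%N -> (l < 4)%N -> (ord4 k == ord4 l) = (k == l).
  by move=> k4 l4; rewrite -val_eqE /= !inordK.
(* the constants h and l of consecutive recurrences cancel *)
have chain (n h l c A A1 B B1 J J1 : R) : n * A = h * A1 -> h * B = l * B1 ->
    l * J = c * J1 -> n * (A * B * J) = c * (A1 * B1 * J1).
  move=> e1 e2 e3; transitivity ((n * A) * B * J); first by ring.
  rewrite e1; transitivity (A1 * (h * B) * J); first by ring.
  by rewrite e2; transitivity (A1 * B1 * (l * J)); [ring | rewrite e3; ring].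
rewrite i4 !oE //; case: i {i4 oE} => [[|[|[|[|k]]]] k4] //=; rewrite /monomial_moment;
  move: (m (ord4 0)) (m (ord4 1)) (m (ord4 2)) (m (ord4 3)) => a b c d;
  rewrite ?add0n ?add1n ?subn0 ?subn1;
  have -> : (a + b + c + d + 3)%N = (a + (b + c + d).+2).+1 by lia.
- apply: chain (trig_moment_cosS _ _ p0 (sinpi R)) erefl erefl.
- have e1 := @trig_moment_sinS R pi a (b + c + d).+2 p0 (sinpi R) isT.
  have e2 := trig_moment_cosS b (c + d).+1 p0 (sinpi R).
  have h : (b + (c + d).+1).+1 = (b + c + d).+2 by lia.
  rewrite h in e2; have := chain _ _ _ _ _ _ _ _ _ _ e1 e2 erefl.
  rewrite !addSn => ->; case: b {e1 e2 h} => [|b]; rewrite ?mul0r //=.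
- have e1 := @trig_moment_sinS R pi a (b + c + d).+2 p0 (sinpi R) isT.
  have e2 := @trig_moment_sinS R pi b (c + d).+1 p0 (sinpi R) isT.
  have h : (b + (c + d).+1).+1 = (b + c + d).+2 by lia.
  rewrite h in e2.
  have := chain _ _ _ _ _ _ _ _ _ _ e1 e2 (trig_moment_cosS c d p20 s2).
  rewrite !addnS !addSn => ->; case: c {e1 e2 h} => [|c]; rewrite ?mul0r //=.
  by rewrite !addnS !addSn.
- have e1 := @trig_moment_sinS R pi a (b + c + d).+2 p0 (sinpi R) isT.
  have e2 := @trig_moment_sinS R pi b (c + d).+1 p0 (sinpi R) isT.
  have h : (b + (c + d).+1).+1 = (b + c + d).+2 by lia.
  rewrite h in e2.
  have e3 : (0 < d)%N || (cos (2 * pi) == 1 :> R) by rewrite c2 orbT.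
  have := chain _ _ _ _ _ _ _ _ _ _ e1 e2 (@trig_moment_sinS R (2 * pi) c d p20 s2 e3).
  rewrite !addnS => ->; case: d {e1 e2 e3 h} => [|d]; rewrite ?mul0r //=.
  by rewrite !addnS.
Qed.

(** By the divergence theorem the integral of x_i p over the sphere is that of
d_i p over the ball, and integration along the rays gives the factor
1 / (k + 3). *)
Lemma mean_divergence i k p : p \is ishomog1 k mdeg ->
  (k + 3)%:R * mean (x_ i * p) = mean (mderiv i p).
Proof.
move=> /dhomogP hp; rewrite {1}[p]mpolyE mulr_sumr linear_sum /= mulr_sumr.
rewrite [in RHS](mpolyE p) (linear_sum (mderiv i)) (linear_sum mean).
rewrite [LHS]big_seq [RHS]big_seq; apply: eq_bigr => m /hp mk.
rewrite -(scalerAr _ (x_ i)) /= mderivZ !meanZ.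
by rewrite -mean_monomial_shift mk mulrCA.
Qed.

End SphereMean.

(** * Zonal harmonics *)

Section Reproducing.
Variable R : realType.
Local Notation poly4 := (mpoly 4 R).
Local Notation x_ i := (mpolyX R (mnm1 i)).
Local Notation homog k := (ishomog1 k mdeg).
Implicit Types (p q H : poly4) (m : multinom 4) (i : 'I_4) (a x : 'rV[R]_4).

(** Let M denote the mean over the sphere. By Euler's identity, M(H) is
proportional to the sum of the M(x_i d_i H), that is, to M(lap H). *)
Lemma mean_harmonic H k : H \is homog k.+1 -> lapl H = 0 -> mean H = 0.
Proof.
move=> hH h0; apply: (@mulfI _ (k.+1%:R * (k + 3)%:R)).
  by rewrite mulf_neq0 // pnatr_eq0 // addn3.
rewrite mulr0 mulrAC -meanZ -(euler hH) mean_sum mulr_suml.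
under eq_bigr => i _ do rewrite mulrC (mean_divergence i (dhomog_mderiv i hH)).
by rewrite -mean_sum -/(lapl H) h0 linear0.
Qed.

(** For a monomial x_i q, [mean_divergence] expresses M(H x_i q) by means of
M(d_i H q) and M(H d_i q), to which the induction applies since d_i H is
harmonic. *)
Lemma harmonic_orthogonal_monomial m k H :
  (mdeg m < k)%N -> H \is homog k -> lapl H = 0 -> mean (H * mpolyX R m) = 0.
Proof.
have [l] := ubnP (mdeg m); elim: l m k H => // l IH m k H ml mk hH h0.
have [m0|m0] := eqVneq m mnm0.
  rewrite m0 mpolyX0 mulr1; case: k mk hH => // k _ hH; exact: mean_harmonic hH h0.
have [i mi] : exists i, m i != 0%N.
  apply/existsP; apply: contraR m0 => /existsPn h; apply/eqP/mnmP => i.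
  by rewrite mnm0E; apply/eqP; have := h i; rewrite negbK.
have mE : m = mnm_add (mnm_sub m (mnm1 i)) (mnm1 i).
  by rewrite submK // lep1mP.
move: (mnm_sub m (mnm1 i)) mE => m' mE.
move: ml mk; rewrite mE mdegD mdeg1 addn1 => ml mk.
case: k mk hH => // k mk hH.
have hp : H * mpolyX R m' \is homog (k.+1 + mdeg m').
  by apply: dhomogM => //; rewrite dhomogX.
have := mean_divergence i hp; rewrite mderivM meanD.
rewrite (IH m' k) //; first last.
- exact: lapl_mderiv.
- exact: dhomog_mderiv.
rewrite mderivX -(scalerAr _ H) meanZ (IH (mnm_sub m' (mnm1 i)) k.+1) //; first last.
- exact: leq_ltn_trans (mdegB _ _) (ltn_trans (ltnSn _) mk).
- exact: leq_ltn_trans (mdegB _ _) ml.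
rewrite mulr0 addr0 => /eqP; rewrite mulf_eq0 pnatr_eq0 addn3 /= => /eqP <-.
by rewrite mpolyXD; congr mean; ring.
Qed.

Lemma harmonic_orthogonal l k H q :
  (l < k)%N -> H \is homog k -> lapl H = 0 -> q \is homog l -> mean (H * q) = 0.
Proof.
move=> lk hH h0 /dhomogP hq; rewrite [q]mpolyE mulr_sumr mean_sum big_seq big1 // => m.
move=> /hq /= ml; rewrite -(scalerAr _ H) meanZ.
by rewrite (harmonic_orthogonal_monomial _ hH) ?mulr0 // ml.
Qed.

(** One factor <., a> is traded for a derivative along a. If it falls on
another such factor, the degree becomes too small and the mean is 0; if it
falls on H, then Euler's identity at a evaluates the result. *)
Lemma harmonic_linform_moment l H a : H \is homog l -> lapl H = 0 ->
  2 ^+ l * l.+1%:R * mean (H * linform a ^+ l) = peval H a.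
Proof.
elim: l H => [|l IH] H hH h0.
  rewrite !expr0 !mulr1 mul1r (dhomog0_const hH) /peval mevalC.
  by rewrite -[mpolyC _ _]mulr1 mul_mpolyC meanZ mean1 mulr1.
pose A := linform a.
have hA j : A ^+ j \is homog j by rewrite -[j in homog j]mul1n; apply/dhomogMn/dhomog_linform.
have key i : (l.+1 + l + 3)%:R * mean (x_ i * (H * A ^+ l)) = mean (mderiv i H * A ^+ l).
  rewrite (mean_divergence i (dhomogM hH (hA l))) mderivM meanD.
  case: l {IH} hH hA => [|l] hH hA.
    by rewrite expr0 -mpolyC1 mderivC mulr0 linear0 addr0.
  have dA : mderiv i (A ^+ l.+1) = (l.+1%:R * a 0 i) *: A ^+ l.
    elim: {hH hA} l => [|l IHl]; first by rewrite !expr1 mderiv_linform mul1r -mul_mpolyC mulr1.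
    rewrite exprS mderivM mderiv_linform IHl mul_mpolyC -(scalerAr _ A) -exprS -scalerDl.
    by congr (_ *: _); rewrite -[l.+2%:R]natr1; ring.
  by rewrite dA -(scalerAr _ H) meanZ (harmonic_orthogonal _ hH h0 (hA l)) ?mulr0 ?addr0.
have sumE : \sum_i a 0 i * mean (x_ i * (H * A ^+ l)) = mean (H * A ^+ l.+1).
  rewrite exprS mulrCA /A [in RHS]/linform mulr_suml mean_sum; apply: eq_bigr => i _.
  by rewrite -scalerAl meanZ.
apply: (@mulfI _ l.+1%:R); first by rewrite pnatr_eq0.
rewrite -(euler_peval a hH).
under eq_bigr => i _.
  rewrite -(IH _ (dhomog_mderiv i hH) (lapl_mderiv i h0)) -/A -key.
  rewrite mulrCA (mulrCA (a 0 i)).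
  over.
rewrite -mulr_sumr -mulr_sumr sumE exprS.
have -> : (l.+1 + l + 3)%:R = 2 * l.+2%:R :> R by rewrite -natrM; congr (_%:R); lia.
by ring.
Qed.

(** On the sphere this is (k + 1) times the Gegenbauer polynomial of parameter
1 in <x, a>, so that its value at a is (k + 1)^2. *)
Definition zonal_poly a k : poly4 := k.+1%:R *: lucas (2 *: linform a) (normsq R 4) k.+1.

Lemma dhomog_lucas a k : lucas (2 *: linform a) (normsq R 4) k.+1 \is homog k.
Proof.
have hs : 2 *: linform a \is homog 1 by apply: rpredZ; exact: dhomog_linform.
elim/nat_ind2: k => [||k IH0 IH1]; first by rewrite /= dhomog1.
  by rewrite /= mulr1 mulr0 subr0.
rewrite lucasSS; apply: rpredB; first exact: (dhomogM hs IH1).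
exact: (dhomogM (dhomog_normsq R 4) IH0).
Qed.

(** Only the first term of the Lucas recurrence counts: in the second one the
factor |x|^2 is 1 on the sphere, and the rest has smaller degree than H. The
powers of 2 <x, a> split off in this way accumulate in the exponent j. *)
Lemma mean_harmonic_lucas H a l j : H \is homog (j + l) -> lapl H = 0 ->
  mean (H * ((2 *: linform a) ^+ j * lucas (2 *: linform a) (normsq R 4) l.+1)) =
  mean (H * (2 *: linform a) ^+ (j + l)).
Proof.
set s := 2 *: linform a; set N := normsq R 4.
have hs k : s ^+ k \is homog k.
  by rewrite -[k in homog k]mul1n; apply: dhomogMn; apply: rpredZ; exact: dhomog_linform.
elim: l j => [|l IH] j hH h0; first by rewrite /= mulr1 addn0.
rewrite lucasSS mulrBr mulrBr meanD raddfN /=.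
have -> : mean (H * (s ^+ j * (N * lucas s N l))) = 0.
  rewrite (_ : _ * _ = N * (H * (s ^+ j * lucas s N l))); last by ring.
  rewrite mean_normsq; case: l IH hH => [|l] IH hH; first by rewrite !mulr0 linear0.
  apply: (harmonic_orthogonal (l := j + l) _ hH h0); first by rewrite ltn_add2l.
  by apply: dhomogM => //; exact: dhomog_lucas.
rewrite oppr0 addr0 mulrA -exprSr IH ?addSnnS //.
Qed.

Lemma zonal_poly_reproducing a k H : H \is homog k -> lapl H = 0 ->
  mean (H * zonal_poly a k) = peval H a.
Proof.
move=> hH h0; rewrite /zonal_poly -(scalerAr _ H) meanZ.
have := @mean_harmonic_lucas H a k 0 hH h0; rewrite expr0 mul1r => ->.
rewrite add0n exprZn -(scalerAr _ H) meanZ -(harmonic_linform_moment a hH h0); ring.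
Qed.

Lemma dhomog_zonal_poly a k : zonal_poly a k \is homog k.
Proof. by apply: rpredZ; exact: dhomog_lucas. Qed.

(** The derivative along a of s = 2 <x, a> is 2 |a|^2 = 2, and that of |x|^2 is
again s. *)
Lemma dirderiv_lucas a k : dotv a a = 1 ->
  dirderiv a (lucas (2 *: linform a) (normsq R 4) k) =
  k%:R * lucas (2 *: linform a) (normsq R 4) k.-1.
Proof.
move=> a1; set s := 2 *: _; set N := normsq R 4.
have d0 c : dirderiv a (mpolyC 4 c) = 0.
  by rewrite /dirderiv big1 // => i _; rewrite mderivC scaler0.
elim/nat_ind2: k => [||k IH0 IH1].
- by rewrite /= -mpolyC0 d0 mpolyC0 mul0r.
- by rewrite /= mulr0 -mpolyC1 d0.
rewrite lucasSS dirderivB !dirderivM IH0 IH1 dirderiv_linform // dirderiv_normsq -/s.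
rewrite -[k.+1.-1]/k -[k.+2.-1]/(k.+1).
case: k {IH0 IH1} => [|k]; first by rewrite /=; ring.
rewrite -[k.+1.-1]/k lucasSS -!natr1; ring.
Qed.

(** The Laplacian of s U_(k+1) is 4 times the derivative of U_(k+1) along a, and
that of |x|^2 U_k is 8 U_k + 4 (k - 1) U_k; both are 4 (k + 1) U_k. *)
Lemma lapl_lucas a k : dotv a a = 1 ->
  lapl (lucas (2 *: linform a) (normsq R 4) k) = 0.
Proof.
move=> a1; set s := 2 *: _; set N := normsq R 4.
have l0 c : lapl (mpolyC 4 c : poly4) = 0.
  by rewrite /lapl big1 // => i _; rewrite mderivC mderiv0.
elim/nat_ind2: k => [||k IH0 IH1].
- by rewrite /= -mpolyC0 l0.
- by rewrite /= -mpolyC1 l0.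
rewrite lucasSS laplB !laplM IH0 IH1 !mulr0 !addr0.
have -> : lapl s = 0.
  rewrite /s laplZ /lapl big1 ?scaler0 // => i _.
  by rewrite mderiv_linform mderivC.
have -> : lapl N = 8.
  rewrite /lapl; under eq_bigr do rewrite mderiv_normsq mderivZ mderivXU eqxx.
  by rewrite big_const_ord iter_addr_0 /= scaler_nat -!mulrnA.
have -> : \sum_i mderiv i s * mderiv i (lucas s N k.+1) = 2 * (k.+1%:R * lucas s N k).
  rewrite -(dirderiv_lucas k.+1 a1) /dirderiv mulr_sumr; apply: eq_bigr => i _.
  by rewrite mderivZ mderiv_linform -scalerAl mul_mpolyC mulr_natl -[RHS]scaler_nat.
have -> : \sum_i mderiv i N * mderiv i (lucas s N k) = 2 * (k.-1%:R *: lucas s N k).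
  case: k {IH0 IH1} => [|k].
    by rewrite /= scaler0 mulr0 big1 // => i _; rewrite mderiv0 mulr0.
  rewrite -(euler (dhomog_lucas a k)) mulr_sumr; apply: eq_bigr => i _.
  by rewrite mderiv_normsq -scalerAl mulr_natl -[RHS]scaler_nat.
rewrite mul0r add0r !scaler_nat.
case: k {IH0 IH1} => [|k]; first by rewrite /=; ring.
rewrite -[k.+1.-1]/k -[k.+2%:R]natr1 -[k.+1%:R]natr1; move: (lucas s N k.+1) => L; ring.
Qed.

Lemma zonal_poly_harmonic a k : dotv a a = 1 -> lapl (zonal_poly a k) = 0.
Proof. by move=> a1; rewrite laplZ lapl_lucas // scaler0. Qed.

Lemma peval_lucas a k x :
  peval (lucas (2 *: linform a) (normsq R 4) k) x = lucas (2 * dotv x a) (dotv x x) k.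
Proof.
rewrite /peval (rmorph_lucas (meval (x 0))) /= mevalZ -!/(peval _ x).
by rewrite peval_linform peval_normsq.
Qed.

Lemma peval_zonal_poly a k x :
  peval (zonal_poly a k) x = k.+1%:R * lucas (2 * dotv x a) (dotv x x) k.+1.
Proof. by rewrite /peval mevalZ -peval_lucas. Qed.

Lemma is_zonal_zonal_poly k a : dotv a a = 1 -> is_zonal k a (zonal_poly a k).
Proof.
move=> a1; split; first by split; [exact: dhomog_zonal_poly | exact: zonal_poly_harmonic].
by move=> p [hp p0]; rewrite sphere_mean_peval zonal_poly_reproducing.
Qed.

(** Write Z_b for the explicit kernel at b. The reproducing property of Z_b,
tested on Z, and that of Z, tested on Z_b, give Z(b) = M(Z Z_b) = Z_b(a) for
every unit vector b. Thus Z is determined on the sphere. *)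
Lemma is_zonal_unique k a Z : dotv a a = 1 -> is_zonal k a Z -> Z = zonal_poly a k.
Proof.
move=> a1 [[hZ Z0] repZ]; apply/eqP; rewrite -subr_eq0; apply/eqP.
apply: (@peval_sphere_eq0 R 4 k _ a) => // [|b b1].
  by apply: rpredB => //; exact: dhomog_zonal_poly.
have [[hA A0] repA] := is_zonal_zonal_poly k a1.
have [hB repB] := is_zonal_zonal_poly k b1.
have e1 := repB _ (conj hZ Z0); have e2 := repZ _ hB.
have e3 := repB _ (conj hA A0); have e4 := repA _ hB.
rewrite /peval mevalB -!/(peval _ _) e1 e3.
rewrite !sphere_mean_peval in e2 e4 *.
by rewrite mulrC -e2 [_ * zonal_poly b k]mulrC -e4 subrr.
Qed.

Lemma zonalE k a x : dotv a a = 1 ->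
  zonal k a x = k.+1%:R * lucas (2 * dotv x a) (dotv x x) k.+1.
Proof.
move=> a1; rewrite /zonal -peval_zonal_poly; congr (peval _ x).
case: xgetP => [Z _ [/(is_zonal_unique a1) //]|/(_ (zonal_poly a k))].
case; split; first exact: is_zonal_zonal_poly.
by move=> Z /(is_zonal_unique a1) ->.
Qed.

Lemma pole1_unit : dotv (pole1 R) (pole1 R) = 1.
Proof.
rewrite /dotv (bigD1 ord0) //= big1 => [|i i0]; last by rewrite mxE (negPf i0) mul0r.
by rewrite mxE !eqxx mulr1 addr0.
Qed.

Lemma dotv_pole1 x : dotv x (pole1 R) = x 0 0.
Proof.
rewrite /dotv (bigD1 ord0) //= big1 => [|i i0]; last by rewrite mxE (negPf i0) mulr0.
by rewrite mxE !eqxx mulr1 addr0.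
Qed.

End Reproducing.

(** * The theorem *)

Theorem proposition5p1 (R : realType) (m : nat) (m_ge1 : (1 <= m)%N)
    (a : 'rV[R]_4) (a_unit : enorm a = 1) :
  let cl := clifford R 3 in
  let pow (y : cl) : cl := y ^+ m in
  let powN (y : cl) : cl := y ^- m in
  let pv : 'rV[R]_4 -> cl := @paravector R 3 in
  [/\ (* (a) *)
      (forall x : 'rV[R]_4,
         (zonal m.-1 (pole1 R) x)%:A = m%:R *: sph_deriv pow (pv x) :> cl) /\
      (forall x : 'rV[R]_4,
         dbar (fun z => pow (pv z)) x
         = - (2 / m%:R) *: (zonal m.-1 (pole1 R) x)%:A),
      (* (b) *)
      forall x : 'rV[R]_4,
        let y : cl := pv x * clconj (pv a) in
        [/\ forall w : 'rV[R]_4, same_re_im y w ->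
              zonal m.-1 a x = zonal m.-1 (pole1 R) w,
            (zonal m.-1 a x)%:A = m%:R *: sph_deriv pow y :> cl &
            m%:R *: sph_deriv pow y
            = m%:R *: \sum_(0 <= k < m)
                         y ^+ (m - k - 1) * (pv a * clconj (pv x)) ^+ k],
      (* (c) *)
      (forall x : 'rV[R]_4, x != 0 ->
         sph_deriv powN (pv x)
         = - kelvin (fun z => sph_deriv pow (pv z)) x) /\
      harmonic_on [set x : 'rV[R]_4 | x != 0]
        (fun x => sph_deriv powN (pv x)) &
      (* (d) *)
      forall x : 'rV[R]_4, enorm x = 1 ->
        sph_deriv pow (pv x)
        = ((gegenbauer 1 m.-1).[clscal (clRe (pv x))])%:A].
Proof.
move=> cl pow powN pv; case: m m_ge1 @pow @powN => // k _ pow powN; rewrite -[k.+1.-1]/k.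
have a1 : dotv a a = 1 by rewrite -enorm_dotv a_unit expr1n.
have sdpow y s N : quadratic y s N -> sph_deriv pow y = (lucas s N k.+1)%:A.
  exact: sph_deriv_pow.
have sdpv x : sph_deriv pow (pv x) = (lucas (2 * x 0 0) (dotv x x) k.+1)%:A.
  exact/sdpow/pv_quadratic.
have zon1 x : zonal k (pole1 R) x = k.+1%:R * lucas (2 * x 0 0) (dotv x x) k.+1.
  by rewrite zonalE ?pole1_unit // dotv_pole1.
have sdpvN x : x != 0 ->
    sph_deriv powN (pv x) = (- lucas (2 * x 0 0) (dotv x x) k.+1 / dotv x x ^+ k.+1)%:A.
  by rewrite -dotv_eq0 => x0; exact: sph_deriv_powN (pv_quadratic x) x0.
split.
- split=> x; first by rewrite zon1 sdpv scalerA.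
  rewrite dbar_pow zon1 !scalerA; congr (_ *: _).
  have k0 : k.+1%:R != 0 :> R by rewrite pnatr_eq0.
  by rewrite [RHS]mulNr mulrA divfK // mulNr.
- move=> x y; have q : quadratic y (2 * dotv x a) (dotv x x).
    by have := pv_conj_quadratic x a; rewrite a1 mulr1.
  split.
  + by move=> w /(same_re_im_quadratic q)[e1 e2]; rewrite zonalE // zon1 e1 e2.
  + by rewrite zonalE // (sdpow _ _ _ q) scalerA.
  + rewrite (sdpow _ _ _ q) -(quadratic_sum k.+1 q) big_mkord; congr (_ *: _).
    apply: eq_bigr => i _; rewrite /y clconjM clconjK; congr (_ ^+ _ * _).
    by rewrite subn1 subSKn.
- split=> [x x0|].
    rewrite sdpvN // /kelvin sdpv enorm_dotv scalerA -scaleNr.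
    congr (_ *: _); set n := dotv x x.
    have n0 : n != 0 by rewrite dotv_eq0.
    rewrite dotvZ -/n mxE mulrCA lucas_scale exprS exprVn; have : n ^+ k != 0 by rewrite expf_neq0.
    by move: (n ^+ k) => u u0; field; rewrite n0 u0.
  apply: (harmonic_on_congr _ _ (@rational_harmonic R cl 1 k
     (- lucas (2 *: linform (pole1 R)) (normsq R 4) k.+1) _ _)).
  + exact: open_punctured.
  + move=> x /set_mem x0; rewrite sdpvN // /rational -peval_normsq.
    congr (_ / _ *: _); rewrite peval_normsq [RHS]mevalN.
    by have := peval_lucas (pole1 R) k.+1 x; rewrite dotv_pole1 => <-.
  + by rewrite rpredN; exact: dhomog_lucas.
  + by rewrite -sub0r laplB lapl_lucas ?pole1_unit // subr0 /lapl big1 // => i _;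
      rewrite !mderiv0.
- move=> x x1; rewrite sdpv -enorm_dotv x1 expr1n gegenbauer1_lucas.
  rewrite (clRe_quadratic (pv_quadratic x)) clscal_alg; congr (lucas _ _ _)%:A.
  by field.
Qed.
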